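(* Let $\mathfrak g$ be a locally semisimple complex Lie algebra which admits a splitting Cartan subalgebra $\mathfrak h\subset\mathfrak g$. Then the category $\mathrm{Int}^{\mathrm{fin}}_{\mathfrak g,\mathfrak h}$ of integrable $\mathfrak h$-weight $\mathfrak g$-modules with finite-dimensional weight spaces is semisimple.
   Context: The ground field is $\mathbb C$. A Lie algebra $\mathfrak g$ is locally semisimple if $\mathfrak g=\bigcup_{i\in\mathbb Z_{>0}}\mathfrak g_i$ for a sequence of inclusions $\mathfrak g_1\subset\mathfrak g_2\subset\cdots$ of finite-dimensional semisimple Lie algebras (an exhaustion of $\mathfrak g$). A $\mathfrak g$-module $M$ is integrable if $\dim\mathrm{span}\{m,g\cdot m,g^2\cdot m,\dots\}<\infty$ for any $m\in M$, $g\in\mathfrak g$; $\mathrm{Int}_{\mathfrak g}$ is the full subcategory of integrable modules in the category of $\mathfrak g$-modules. A splitting Cartan subalgebra is an abelian subalgebra $\mathfrak h\subset\mathfrak g$ such that $\mathfrak g=\mathfrak h\oplus\bigoplus_{0\ne\alpha\in\mathfrak h^*}\mathfrak g^\alpha$, where $\mathfrak g^\alpha=\{g\in\mathfrak g\mid [h,g]=\alpha(h)g \text{ for all } h\in\mathfrak h\}$. $\mathrm{Int}^{\mathrm{wt}}_{\mathfrak g,\mathfrak h}$ is the full subcategory of $\mathrm{Int}_{\mathfrak g}$ of modules $M$ with $M=\bigoplus_{\alpha\in\mathfrak h^*}M^\alpha$, where $M^\alpha=\{m\in M\mid h\cdot m=\alpha(h)m\text{ for all }h\in\mathfrak h\}$.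 $\mathrm{Int}^{\mathrm{fin}}_{\mathfrak g,\mathfrak h}$ is the full subcategory of $\mathrm{Int}^{\mathrm{wt}}_{\mathfrak g,\mathfrak h}$ of modules $M$ with $\dim M^\alpha<\infty$ for every $\alpha\in\mathfrak h^*$. Semisimple means that every object is a (possibly infinite) direct sum of simple objects. *)

(* Defs.v *)
From HB Require Import structures.
From mathcomp Require Import all_boot all_order all_algebra.
From mathcomp Require Import all_classical all_reals.
From mathcomp Require Export complex.

Set Implicit Arguments.
Unset Strict Implicit.
Unset Printing Implicit Defensive.
Import GRing.Theory.
Local Open Scope classical_set_scope.
Local Open Scope ring_scope.

(* Vector spaces are of arbitrary dimension: subspaces are classical sets, as *)
(* {vspace V} only covers the finite-dimensional case.                        *)

Definition linear_subspace (K : fieldType) (V : lmodType K) (S : set V) : Prop :=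
  S 0 /\ forall (a : K) (u v : V), S u -> S v -> S (a *: u + v).

Definition linear_span (K : fieldType) (V : lmodType K) (X : set V) : set V :=
  smallest (@linear_subspace K V) X.

Definition finite_dim (K : fieldType) (V : lmodType K) (S : set V) : Prop :=
  exists s : seq V, S = linear_span [set` s].

(* V is the internal direct sum of the family of subspaces F. The index type  *)
(* is arbitrary, so finite subfamilies are given by injections from 'I_n.     *)
Definition direct_sum (K : fieldType) (V : lmodType K) (I : Type)
    (F : I -> set V) : Prop :=
  linear_span (\bigcup_i F i) = setT /\
  forall (n : nat) (i : 'I_n -> I) (v : 'I_n -> V), injective i ->
    (forall k, F (i k) (v k)) -> \sum_(k < n) v k = 0 -> forall k, v k = 0.

HB.mixin Record Lmodule_isLieAlgebra (K : fieldType) g of GRing.Lmodule K g := {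
  bracket : g -> g -> g;
  bracket_linearl : forall (a : K) (x y z : g),
    bracket (a *: x + y) z = a *: bracket x z + bracket y z;
  bracket_linearr : forall (a : K) (x y z : g),
    bracket x (a *: y + z) = a *: bracket x y + bracket x z;
  bracketxx : forall x : g, bracket x x = 0;
  jacobi : forall x y z : g,
    bracket x (bracket y z) + bracket y (bracket z x) +
    bracket z (bracket x y) = 0
}.

#[short(type="lieAlgType")]
HB.structure Definition LieAlgebra (K : fieldType) :=
  {g of GRing.Lmodule K g & Lmodule_isLieAlgebra K g}.

HB.mixin Record Lmodule_isLieModule (K : fieldType) (g : lieAlgType K) M
    of GRing.Lmodule K M := {
  lie_act : g -> M -> M;
  act_linearl : forall (a : K) (x y : g) (m : M),
    lie_act (a *: x + y) m = a *: lie_act x m + lie_act y m;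
  act_linearr : forall (a : K) (x : g) (m n : M),
    lie_act x (a *: m + n) = a *: lie_act x m + lie_act x n;
  act_bracket : forall (x y : g) (m : M),
    lie_act (bracket x y) m = lie_act x (lie_act y m) - lie_act y (lie_act x m)
}.

#[short(type="lieModType")]
HB.structure Definition LieModule (K : fieldType) (g : lieAlgType K) :=
  {M of GRing.Lmodule K M & Lmodule_isLieModule K g M}.

Section LieAlgebras.
Variables (K : fieldType) (g : lieAlgType K).
Implicit Types S I : set g.

Definition lie_subalgebra S : Prop :=
  linear_subspace S /\ forall x y, S x -> S y -> S (bracket x y).

Definition lie_ideal S I : Prop :=
  [/\ linear_subspace I, I `<=` S & forall x y, S x -> I y -> I (bracket x y)].

Definition lie_derived S : set g := linear_span [set bracket x y | x in S & y in S].

Definition lie_solvable S : Prop := exists n : nat, iter n lie_derived S = [set 0].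

(* The zero algebra counts as semisimple. *)
Definition semisimple S : Prop :=
  forall I, lie_ideal S I -> lie_solvable I -> I = [set 0].

Definition locally_semisimple : Prop :=
  exists G : nat -> set g,
    [/\ forall i, [/\ lie_subalgebra (G i), finite_dim (G i) & semisimple (G i)],
        forall i, G i `<=` G i.+1
      & \bigcup_i G i = setT].

Section Cartan.
(* The subspace h is given by its predicate P together with the vector space  *)
(* of its elements, so that its dual is {scalar h}.                           *)
Variables (P : {pred g}) (h : subLmodType P).

Definition root_space (alpha : {scalar h}) : set g :=
  [set x | forall t : h, bracket (val t) x = alpha t *: x].

(* None indexes the summand h itself. *)
Definition cartan_summand
    (i : option {alpha : {scalar h} | ~ (alpha =1 \0)}) : set g :=
  if i is Some alpha then root_space (sval alpha) else [set` P].

(* An abelian subspace is automatically a subalgebra. *)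
Definition splitting_cartan : Prop :=
  (forall s t : h, bracket (val s) (val t) = 0) /\ direct_sum cartan_summand.

Definition weight_space (M : lieModType g) (alpha : {scalar h}) : set M :=
  [set m | forall t : h, lie_act (val t) m = alpha t *: m].

End Cartan.

(* Full subcategories of the category of g-modules are given by their class   *)
(* of objects.                                                                *)

Definition Int_g (M : lieModType g) : Prop :=
  forall (x : g) (m : M),
    finite_dim (linear_span (range (fun n : nat => iter n (lie_act x) m))).

Definition Int_wt (P : {pred g}) (h : subLmodType P) (M : lieModType g) : Prop :=
  Int_g M /\ direct_sum (@weight_space P h M).

Definition Int_fin (P : {pred g}) (h : subLmodType P) (M : lieModType g) : Prop :=
  Int_wt h M /\ forall alpha : {scalar h}, finite_dim (@weight_space P h M alpha).

Definition module_hom (M N : lieModType g) (f : {linear M -> N}) : Prop :=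
  forall (x : g) (m : M), f (lie_act x m) = lie_act x (f m).

Definition simple_object (C : lieModType g -> Prop) (S : lieModType g) : Prop :=
  [/\ C S, exists m : S, m != 0
    & forall (N : lieModType g) (f : {linear N -> S}),
        C N -> module_hom f -> injective f ->
        range f = [set 0] \/ range f = setT].

Definition semisimple_category (C : lieModType g -> Prop) : Prop :=
  forall M : lieModType g, C M ->
    exists (I : Type) (S : I -> lieModType g)
           (iota : forall i, {linear S i -> M}),
      [/\ forall i, simple_object C (S i),
          forall i, module_hom (iota i) /\ injective (iota i)
        & direct_sum (fun i => range (iota i))].

End LieAlgebras.

(* Main.v *)
(* Weyl's theorem holds for each term G_i of the exhaustion: Cartan's
   criterion makes trace forms nondegenerate, and the Casimir element kills
   H^1. The terms need not be stable under h, but g is spanned by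
   h-homogeneous elements, and the weight-zero part of a G_i-equivariant
   projection still commutes with the homogeneous elements of G_i.

   Given a submodule N of M not containing the weight space M^l, choose a
   submodule X with X^l not in N and dim X^l minimal, and replace it by the
   one that X^l generates. As M^l is finite-dimensional, the weight-zero part
   of U(g) acts on it through finitely many words, which lie in some G_i. A
   G_i-equivariant projection onto Y = X /\ N then splits Y^l off X^l
   compatibly with U(g), so Y^l = 0 by minimality, and Y = 0 since X is
   generated by X^l. For the same reason X is simple. Zorn's lemma concludes. *)

From HB Require Import structures.
Require Import Defs.
From mathcomp Require Import all_boot all_order all_algebra.
From mathcomp Require Import all_classical all_reals.
From mathcomp Require Import ring.

Set Implicit Arguments.
Unset Strict Implicit.
Unset Printing Implicit Defensive.
Import Order.TTheory GRing.Theory Num.Theory.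
Local Open Scope classical_set_scope.
Local Open Scope ring_scope.

(** Integrability bounds only the orbits of single elements, whereas Weyl's theorem needs
    finite-dimensional modules over [G i]. A straightening argument in the style of
    Poincare-Birkhoff-Witt bridges the gap: a finite-dimensional subspace generates a
    finite-dimensional module over a finite-dimensional subalgebra. Equivariant projections
    therefore live on such a subspace [E] only. As [G i] is unrelated to [h], the weight projections
    [p l] may leave [E]; that certain vectors stay in [E] is seen on words in homogeneous letters
    that happen to lie in [G i].

    Semisimplicity is given as the absence of solvable ideals, so Engel's theorem and Cartan's
    criterion come first, for matrices. There, complex conjugation of the eigenvalues plays the part
    of the usual rational linear functionals: a sum of squared moduli vanishes only if every
    eigenvalue does. *)

Definition linear_of (K : fieldType) (U W : lmodType K) (f : U ->
  W) (_ : linear f) := f.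
HB.instance Definition _ (K : fieldType) (U W : lmodType K) (f : U -> W)
  (f_lin : linear f) := GRing.isLinear.Build K U W *:%R (linear_of f_lin) f_lin.

(** * Linear subspaces as sets, in arbitrary dimension *)

Section LinearSets.
Variables (K : fieldType) (V : lmodType K).
Implicit Types (S T X : set V) (u v : V).

Lemma linear_span_subspace X : linear_subspace (linear_span X).
Proof.
split=> [U [[U0 _] _]//|a u v Xu Xv U UX].
by have [[_ UD] _] := UX; apply: UD; [apply: Xu|apply: Xv].
Qed.

Lemma zero_subspace : linear_subspace [set 0 : V].
Proof. by split=> // a u v -> ->; rewrite scaler0 addr0. Qed.

Lemma full_subspace : linear_subspace [set: V].
Proof. by []. Qed.

Lemma sub_linear_span X : X `<=` linear_span X.
Proof. by move=> x Xx U [_]; apply. Qed.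

Lemma linear_span_sub X S : linear_subspace S -> X `<=` S ->
  linear_span X `<=` S.
Proof. by move=> SS XS x; apply. Qed.

Lemma linear_span_mono X Y : X `<=` Y -> linear_span X `<=` linear_span Y.
Proof.
move=> XY; apply: linear_span_sub; first exact: linear_span_subspace.
by move=> x /XY; apply: sub_linear_span.
Qed.

Section Closure.
Variables (S : set V) (SS : linear_subspace S).

Lemma subspace0 : S 0. Proof. by case: SS. Qed.

Lemma subspaceZ a u : S u -> S (a *: u).
Proof. by move=> Su; rewrite -[_ *: _]addr0; apply: SS.2 => //; case: SS. Qed.

Lemma subspaceD u v : S u -> S v -> S (u + v).
Proof. by move=> Su Sv; rewrite -[u]scale1r; apply: SS.2. Qed.

Lemma subspaceN u : S u -> S (- u).
Proof. by rewrite -scaleN1r; apply: subspaceZ. Qed.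

Lemma subspaceB u v : S u -> S v -> S (u - v).
Proof. by move=> Su Sv; apply: subspaceD => //; apply: subspaceN. Qed.

Lemma subspace_sum (I : Type) (r : seq I) (P : pred I) (F : I -> V) :
  (forall i, P i -> S (F i)) -> S (\sum_(i <- r | P i) F i).
Proof.
move=> SF; elim/big_ind: _ => //; first exact: subspace0.
by move=> *; apply: subspaceD.
Qed.

End Closure.
End LinearSets.

Lemma image_subspace (K : fieldType) (V W : lmodType K) (f : {linear V -> W})
  (S : set V) : linear_subspace S -> linear_subspace (f @` S).
Proof.
move=> SS; split; first by exists 0; [exact: subspace0|rewrite linear0].
move=> a _ _ [u Su <-] [v Sv <-]; exists (a *: u + v); first exact: SS.2.
by rewrite linearP.
Qed.

Lemma preimage_subspace (K : fieldType) (V W : lmodType K) (f : {linear V -> W})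
  (S : set W) : linear_subspace S -> linear_subspace (f @^-1` S).
Proof.
move=> SS; split=> [|a u v Su Sv]; first by rewrite /= linear0;
  apply: subspace0.
by rewrite /= linearP; apply: SS.2.
Qed.

Lemma linear_span_image (K : fieldType) (V W : lmodType K) (f : {linear V -> W})
  (X : set V) : linear_span (f @` X) = f @` linear_span X.
Proof.
apply/seteqP; split.
  apply: linear_span_sub; first exact/image_subspace/linear_span_subspace.
  by apply: image_subset; apply: sub_linear_span.
move=> _ [x Xx <-].
suff /(_ _ Xx) : linear_span X `<=` f @^-1` (linear_span (f @` X)) by [].
apply: linear_span_sub.
  exact/preimage_subspace/linear_span_subspace.
by move=> y Xy; exact: (sub_linear_span (imageP f Xy)).
Qed.

(** * Polynomial functions of an operator *)

Section Interpolation.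
Variable F : fieldType.
Implicit Types (s : seq F) (p q : {poly F}).

Lemma coprimep_XsubC_exp s c k :
  c \notin s -> coprimep (\prod_(b <- s) ('X - b%:P) ^+ k) (('X - c%:P) ^+ k).
Proof.
move=> cs; apply: coprimep_expr; elim: s cs => [|b s IHs].
  by rewrite big_nil coprime1p.
rewrite inE negb_or big_cons => /andP[cb cs].
rewrite coprimepMl IHs// andbT coprimep_expl// coprimep_XsubC2//.
by rewrite subr_eq0.
Qed.

Lemma prod_XsubC_exp_dvdp s k p : uniq s ->
  (forall c, c \in s -> ('X - c%:P) ^+ k %| p) ->
  \prod_(c <- s) ('X - c%:P) ^+ k %| p.
Proof.
elim: s => [|b s IHs] /=; first by rewrite big_nil dvd1p.
move=> /andP[bs us] H; rewrite big_cons Gauss_dvdp; last first.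
  by rewrite coprimep_sym coprimep_XsubC_exp.
by rewrite H ?mem_head//= IHs// => c cs; rewrite H// inE cs orbT.
Qed.

(** Chinese remainder theorem for the coprime moduli [('X - c%:P) ^+ k] and constant residues. For
    [k] large, [q] evaluated at an operator acts as the scalar [v c] on its generalized
    [c]-eigenspace. *)
Lemma poly_interpolation s k (v : F -> F) : uniq s ->
  exists q, forall c, c \in s -> ('X - c%:P) ^+ k %| q - (v c)%:P.
Proof.
elim: s => [|c s IHs] /=; first by exists 0.
move=> /andP[cs /IHs[q Hq]].
have /Bezout_eq1_coprimepP[[a b] /= ab1] := coprimep_XsubC_exp k cs.
set P := \prod_(_ <- _) _ in ab1.
(* By the Bezout relation, [a * P] is 0 modulo the moduli at the points of [s] and 1 modulo the one
   at [c], so the correction changes only the residue at [c]. *)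
exists (q + a * P * ((v c)%:P - q)) => e; rewrite inE => /predU1P[->|es].
  have -> : q + a * P * ((v c)%:P - q) - (v c)%:P =
      (b * (q - (v c)%:P)) * ('X - c%:P) ^+ k.
    have bE : b * ('X - c%:P) ^+ k = 1 - a * P by rewrite -ab1 [RHS]addrC addKr.
    by rewrite [RHS]mulrAC bE; ring.
  exact: dvdp_mull.
rewrite addrAC dvdp_add ?Hq// dvdp_mulr// dvdp_mull//.
by rewrite /P (big_rem e es)/= dvdp_mulr.
Qed.

End Interpolation.

Section PolyAct.
Variables (K : fieldType) (V : lmodType K) (D : {linear V -> V}).

(** The operator is evaluated vector by vector, since [D] need not be a matrix: it will be [mxbr X]
    on a space of matrices. *)
Definition poly_act (p : {poly K}) (v : V) : V :=
  \sum_(i < size p) p`_i *: iter i D v.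

Lemma poly_actE n (p : {poly K}) v : (size p <= n)%N ->
  poly_act p v = \sum_(i < n) p`_i *: iter i D v.
Proof.
move=> pn; rewrite /poly_act (big_ord_widen n (fun i => p`_i *: iter i D v))//.
rewrite big_mkcond; apply: eq_bigr => i _; case: ltnP => // H.
by rewrite nth_default ?scale0r.
Qed.

Lemma iterD_linear n a (u v : V) :
  iter n D (a *: u + v) = a *: iter n D u + iter n D v.
Proof. by elim: n => //= n ->; rewrite linearP. Qed.

Lemma poly_act_is_linear p : linear (poly_act p).
Proof.
move=> a u v; rewrite /poly_act scaler_sumr -big_split/=; apply: eq_bigr => i _.
by rewrite iterD_linear scalerDr !scalerA mulrC.
Qed.
HB.instance Definition _ p :=
  GRing.isLinear.Build K V V *:%R (poly_act p) (poly_act_is_linear p).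

Lemma poly_actD (p q : {poly K}) v : poly_act
  (p + q) v = poly_act p v + poly_act q v.
Proof.
rewrite !(@poly_actE (maxn (size p) (size q))) ?leq_maxl ?leq_maxr
  ?size_polyD//.
by rewrite -big_split/=; apply: eq_bigr => i _; rewrite coefD scalerDl.
Qed.

Lemma poly_actC c v : poly_act c%:P v = c *: v.
Proof.
by rewrite (@poly_actE 1) ?size_polyC ?leq_b1// big_ord1 coefC eqxx.
Qed.

Lemma poly_actMX (p : {poly K}) v : poly_act (p * 'X) v = poly_act p (D v).
Proof.
rewrite (@poly_actE (size p).+1) ?(leq_trans (size_polyMleq _ _))//; last first.
  by rewrite size_polyX addn2.
rewrite big_ord_recl coefMX eqxx scale0r add0r; apply: eq_bigr => i _.
by rewrite coefMX/= -iterSr.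
Qed.

Lemma poly_actM (p q : {poly K}) v : poly_act (p * q) v = poly_act p
  (poly_act q v).
Proof.
elim/poly_ind: q v => [|q c IHq] v.
  by rewrite mulr0 -polyC0 !poly_actC scale0r linear0.
rewrite mulrDr mulrA !poly_actD !poly_actMX IHq linearD poly_actC.
rewrite [p * _]mulrC mul_polyC /=; congr (_ + _).
elim/poly_ind: p v {IHq} => [|p d IHp] v.
  by rewrite scaler0 -polyC0 !poly_actC !scale0r.
rewrite scalerDr scalerAl !poly_actD !poly_actMX IHp [D (c *: v)]linearZ/=.
by rewrite -mul_polyC -polyCM !poly_actC !scalerA mulrC.
Qed.

Lemma poly_actXsubC_exp c k v :
  poly_act (('X - c%:P) ^+ k) v = iter k (fun w => D w - c *: w) v.
Proof.
elim: k v => [|k IHk] v; first by rewrite expr0 -polyC1 poly_actC scale1r.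
rewrite exprSr poly_actM IHk iterSr -polyCN poly_actD poly_actC scaleNr.
by rewrite -['X]mul1r poly_actMX -polyC1 poly_actC scale1r.
Qed.

Lemma poly_act_stable (T : set V) (p : {poly K}) v : linear_subspace T ->
  (forall w, T w -> T (D w)) -> T v -> T (poly_act p v).
Proof.
move=> [T0 TD] TS Tv.
have Ti i : T (iter i D v) by elim: i => //= i /TS.
rewrite /poly_act; elim/big_ind: _ => // [x y Tx Ty|i _].
  by rewrite -[x]scale1r; apply: TD.
by rewrite -[X in T X]addr0; apply: TD.
Qed.

End PolyAct.

(** * Trace forms and nilpotent matrices *)

Definition mxbr (F : fieldType) n (A B : 'M[F]_n) := A *m B - B *m A.

Lemma mxbr_is_linear (F : fieldType) n (A : 'M[F]_n) : linear (mxbr A).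
Proof.
move=> a X Y; rewrite /mxbr mulmxDr mulmxDl -scalemxAr -scalemxAl.
by rewrite opprD addrACA scalerBr.
Qed.
HB.instance Definition _ (F : fieldType) n (A : 'M[F]_n) :=
  GRing.isLinear.Build F 'M[F]_n 'M[F]_n *:%R (mxbr A) (mxbr_is_linear A).

Section CartanNilpotent.
Variables (C : numClosedFieldType) (n' : nat).
Local Notation n := n'.+1.
Implicit Types (A B X Y : 'M[C]_n).

Lemma trig_horner X (p : {poly C}) : is_trig_mx X ->
  is_trig_mx (horner_mx X p) /\ forall i, horner_mx X p i i = p.[X i i].
Proof.
move=> Xt; elim/poly_ind: p => [|p c [/is_trig_mxP IHt IHd]].
  by rewrite rmorph0 mx0_is_trig; split=> // i; rewrite mxE horner0.
rewrite rmorphD rmorphM/= horner_mx_X horner_mx_C.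
split=> [|i].
  apply/is_trig_mxP => i j ij; rewrite !mxE big1 ?add0r => [|k _].
    by rewrite -val_eqE ltn_eqF.
  case: (ltnP i k) => ik; first by rewrite IHt ?mul0r.
  by rewrite (is_trig_mxP Xt k j) ?mulr0 ?(leq_ltn_trans ik).
rewrite !mxE !hornerE eqxx mulr1n (bigD1 i)//= IHd big1 ?addr0// => k ki.
case: (ltngtP i k) => ik; first by rewrite IHt ?mul0r.
  by rewrite (is_trig_mxP Xt k i) ?mulr0.
by rewrite (val_inj ik) eqxx in ki.
Qed.

(** [d] is the diagonal of a Schur triangular form, that is, the eigenvalues with multiplicity. The
    first property is Cayley-Hamilton; the second holds because a polynomial in a triangular matrix
    is triangular. *)
Lemma triangularization X : exists2 d : 'I_n -> C,
  horner_mx X (\prod_i ('X - (d i)%:P)) = 0 &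
  forall p, \tr (horner_mx X p) = \sum_i p.[d i].
Proof.
have [P /unitarymx_unit Pu Xt] := Schur X (ltn0Sn n').
set T := conjmx P X in Xt.
have XE : X = invmx P *m T *m invmx (invmx P).
  by rewrite invmxK /T conjumx// !mulmxA mulVmx// mul1mx mulmxKV.
have XpE p : horner_mx X p = invmx P *m horner_mx T p *m P.
  by rewrite XE horner_mx_uconj ?invmxK//; move: Pu; rewrite -unitmx_inv.
exists (fun i => T i i) => [|p].
  by rewrite XpE -char_poly_trig// Cayley_Hamilton mulmx0 mul0mx.
rewrite XpE mxtrace_mulC mulmxA mulmxV// mul1mx.
by apply: eq_bigr => i _; have [_ ->] := trig_horner p Xt.
Qed.

(** [mxbr X - (a - b)] is left multiplication by [X - a%:M] minus right multiplication by
    [X - b%:M]. These commute, and each term of the expanded power contains the first at least [i]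
    times or the second at least [j] times. *)
Lemma ad_nilp X a b B i j :
  (X - a%:M) ^+ i *m B = 0 -> B *m (X - b%:M) ^+ j = 0 ->
  iter (i + j) (fun Y => mxbr X Y - (a - b) *: Y) B = 0.
Proof.
have DE Y : mxbr X Y - (a - b) *: Y = (X - a%:M) *m Y - Y *m (X - b%:M).
  rewrite /mxbr mulmxBl mulmxBr mul_scalar_mx mul_mx_scalar scalerBl.
  by rewrite !opprD addrACA.
have iterD k Y Z : iter k (fun Y => mxbr X Y - (a - b) *: Y) (Y - Z) =
    iter k (fun Y => mxbr X Y - (a - b) *: Y) Y -
    iter k (fun Y => mxbr X Y - (a - b) *: Y) Z.
  elim: k => //= k ->; rewrite linearB/= scalerBr !opprD.
  by rewrite addrACA.
have iter0 k : iter k (fun Y => mxbr X Y - (a - b) *: Y) 0 = 0.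
  by elim: k => //= k ->; rewrite linear0 scaler0 subr0.
elim: i j B => [|i IHi] j B.
  by rewrite expr0 mul1mx => -> _; rewrite iter0.
elim: j B => [|j IHj] B; first by rewrite expr0 mulmx1 => _ ->; rewrite iter0.
move=> Bi Bj; rewrite addSn iterSr DE iterD.
rewrite IHi//; last by rewrite -mulmxA Bj mulmx0.
  rewrite -addSnnS IHj ?subrr//; first by rewrite mulmxA Bi mul0mx.
  by rewrite -mulmxA -[_ *m _ ^+ _]exprS.
by rewrite mulmxA -[_ ^+ _ *m _]exprSr.
Qed.

(* [Y] acts as [a^*] on the generalized [a]-eigenspace of [X]. Then [mxbr Y]
   is a polynomial in [mxbr X] without constant term, and [\tr (X *m Y)] is
   the sum of the squared moduli of the eigenvalues of [X]. *)
Lemma cartan_semisimple_part X : exists Y q,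
  (\tr (X *m Y) = 0 -> X ^+ n = 0) /\
  forall B, mxbr Y B = poly_act (mxbr X) q (mxbr X B).
Proof.
have [d dX trX] := triangularization X.
pose s := undup [seq d i | i <- enum 'I_n].
have us : uniq s by rewrite undup_uniq.
have ds i : d i \in s by rewrite mem_undup map_f ?mem_enum.
have vanish (p : {poly C}) : (forall c, c \in s -> ('X - c%:P) ^+ n %| p) ->
    horner_mx X p = 0.
  move=> /(prod_XsubC_exp_dvdp us) Hp.
  (* Grouping equal eigenvalues turns this product into powers of distinct linear factors, with
     exponents at most [n]. *)
  suff /dvdpP[q ->] : \prod_i ('X - (d i)%:P) %| p.
    by rewrite rmorphM/= dX mulr0.
  apply: dvdp_trans Hp; rewrite -(big_enum _ _ _ (fun i => 'X - (d i)%:P)).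
  rewrite -(big_map d xpredT (fun c => 'X - c%:P)) -big_undup_iterop_count/=.
  apply: (big_ind2 (fun p q => p %| q)) => // [p1 p2 q1 q2|c _].
    exact: dvdp_mul.
  rewrite -[iterop _ _ _ _]/(_ ^+ _) dvdp_exp2l//.
  rewrite (leq_trans (count_size _ _))//.
  by rewrite size_map size_enum_ord.
have [f Hf] := poly_interpolation n (fun c : C => c^*) us.
(* Interpolating the indicator of [a] makes [E a] the projection onto the generalized
   [a]-eigenspace. *)
have /choice[e He] : forall a : C, exists e, forall c, c \in s ->
    ('X - c%:P) ^+ n %| e - (c == a)%:R%:P.
  by move=> a; apply: (poly_interpolation n (fun c => (c == a)%:R) us).
pose Y := horner_mx X f; pose E a := horner_mx X (e a).
have EC a b : comm_mx (E a) (horner_mx X b) by apply: comm_horner_mx2.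
have sumE : \sum_(a <- s) E a = 1%:M.
  apply/eqP; rewrite -subr_eq0 -(rmorph_sum (horner_mx X)) -(horner_mx_C X).
  rewrite -rmorphB polyC1; apply/eqP/vanish => c cs.
  have -> : \sum_(a <- s) e a - 1 = \sum_(a <- s) (e a - (c == a)%:R%:P).
    rewrite sumrB; congr (_ - _); rewrite (bigD1_seq c)//= eqxx big1 ?addr0//.
    by move=> a; rewrite eq_sym => /negPf ->.
  rewrite big_seq; elim/big_ind: _ => [|p1 p2|a _]; first exact: dvdp0.
    exact: dvdp_add.
  exact: He.
have eE a p : a \in s -> ('X - a%:P) ^+ n %| p -> horner_mx X p *m E a = 0.
  move=> sa ap; rewrite -[_ *m _]rmorphM/=; apply: vanish => c cs.
  have [->|ca] := eqVneq c a; first by rewrite dvdp_mulr.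
  by rewrite dvdp_mull//; have := He a c cs; rewrite (negPf ca) subr0.
have YE a : a \in s -> Y *m E a = a^* *: E a.
  move=> sa; apply/eqP; rewrite -subr_eq0 -mul_scalar_mx -mulmxBl.
  by rewrite -(horner_mx_C X) -rmorphB eE ?Hf.
have XnP a : (X - a%:M) ^+ n = horner_mx X (('X - a%:P) ^+ n).
  by rewrite rmorphXn rmorphB/= horner_mx_X horner_mx_C.
have XnE a : a \in s -> (X - a%:M) ^+ n *m E a = 0.
  by move=> sa; rewrite XnP eE.
(* The eigenvalues of [mxbr X] are among these differences, and the exponent [n + n] below is the
   one that [ad_nilp] gives for [i = j = n]. *)
pose sd := undup [seq a - b | a <- s, b <- s].
have [q Hq] := poly_interpolation (n + n) (fun c : C =>
  c^*) (undup_uniq [seq a - b | a <- s, b <- s]).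
have sdP a b : a \in s -> b \in s -> a - b \in sd.
  by move=> sa sb; rewrite mem_undup; apply/allpairsP; exists (a, b).
have qE a b B : a \in s -> b \in s ->
    poly_act (mxbr X) q (E a *m B *m E b) = (a - b)^* *: (E a *m B *m E b).
  move=> sa sb; have /dvdpP[r rE] := Hq _ (sdP _ _ sa sb).
  rewrite -[q](subrK (a - b)^*%:P) poly_actD poly_actC rE poly_actM.
  rewrite poly_actXsubC_exp ad_nilp ?linear0 ?add0r//.
    by rewrite !mulmxA XnE// !mul0mx.
  rewrite -!mulmxA; suff -> : E b *m (X - b%:M) ^+ n = 0 by rewrite !mulmx0.
  by rewrite XnP EC -XnP XnE.
have BE B : mxbr Y B = poly_act (mxbr X) q B.
  have -> : B = \sum_(a <- s) \sum_(b <- s) E a *m B *m E b.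
    transitivity ((\sum_(a <- s) E a) *m B *m (\sum_(b <- s) E b)).
      by rewrite sumE mul1mx mulmx1.
    rewrite !mulmx_suml; apply: eq_bigr => a _.
    by rewrite mulmx_sumr.
  rewrite !linear_sum/= big_seq [RHS]big_seq; apply: eq_bigr => a sa.
  rewrite !linear_sum/= big_seq [RHS]big_seq; apply: eq_bigr => b sb.
  rewrite qE// /mxbr !mulmxA YE// -scalemxAl -[_ *m E b *m Y]mulmxA EC YE//.
  by rewrite -scalemxAr -scalemxAl -scalerBl rmorphB.
have /dvdpP[q1 q1E] : 'X %| q.
  have s0 : 0 \in sd by rewrite -(subrr (d ord0)) sdP.
  have := Hq 0 s0; rewrite conjC0 !subr0; apply: dvdp_trans.
  by rewrite addSn exprS dvdp_mulr.
exists Y, q1; split=> [tr0|B]; last by rewrite BE q1E poly_actMX.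
have d0 i : d i = 0.
  move: tr0; rewrite -{1}(horner_mx_X X) -[_ *m _]rmorphM/= trX => tr0.
  have fd j : f.[d j] = (d j)^*.
    have /dvdpP[r rE] := Hf _ (ds j).
    by rewrite -[f](subrK (d j)^*%:P) rE !hornerE subrr expr0n/= mulr0 add0r.
  have : \sum_i `|d i| ^+ 2 = 0.
    rewrite -[RHS]tr0; apply: eq_bigr => j _.
    by rewrite hornerM hornerX fd normCK.
  move=> /eqP; rewrite psumr_eq0 => [/allP/(_ i (mem_index_enum _))|j _].
    by rewrite expf_eq0/= normr_eq0 => /eqP.
  by rewrite exprn_ge0.
have := dX; rewrite (eq_bigr (fun => 'X)) => [|i _]; last by rewrite d0 subr0.
by rewrite prodr_const card_ord rmorphXn/= horner_mx_X.
Qed.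

(** The conjugate part [Y] of [X] need not lie in [S], so the hypothesis says nothing directly about
    [\tr (X *m Y)]. But [mxbr Y] is a polynomial in [mxbr X] without constant term, hence maps [S]
    into [T], and cyclicity of the trace moves [Y] into such a bracket. *)
Lemma cartan_nilpotent (S : set 'M[C]_n) : linear_subspace S ->
  (forall A B, S A -> S B -> S (mxbr A B)) ->
  let T := linear_span [set mxbr A B | A in S & B in S] in
  (forall A B, T A -> S B -> \tr (A *m B) = 0) ->
  forall X, T X -> X ^+ n = 0.
Proof.
move=> Ssub Sbr T trT X TX.
have [Y [q [nilX YE]]] := cartan_semisimple_part X.
have TS : T `<=` S.
  by apply: linear_span_sub => // _ [A SA [B SB <-]]; apply: Sbr.
have brT A B : S A -> S B -> T (mxbr A B).
  by move=> SA SB; exact: (sub_linear_span (ex_intro2 _ _ A SA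
    (ex_intro2 _ _ B SB erefl))).
apply: nilX.
have brYT B : S B -> T (mxbr Y B).
  move=> SB; rewrite YE.
  apply: (@poly_act_stable _ _ _ T) => [|A TA|];
    first exact: linear_span_subspace.
    by apply: brT; apply: TS.
  by apply: brT => //; apply: TS.
suff /(_ _ TX) : T `<=` [set A | \tr (A *m Y) = 0] by [].
apply: linear_span_sub.
  split=> [|a A B /= A0 B0]; first by rewrite /= mul0mx mxtrace0.
  by rewrite mulmxDl mxtraceD -scalemxAl mxtraceZ A0 B0 mulr0 addr0.
move=> _ [A SA [B SB <-]] /=.
have -> : \tr (mxbr A B *m Y) = - \tr (mxbr Y B *m A).
  rewrite /mxbr !mulmxBl !mxtraceD -!scaleN1r !mxtraceZ -!mulmxA !mulN1r opprD
    opprK [RHS]addrC.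
  congr (_ - _).
    by rewrite mxtrace_mulC mulmxA.
  by rewrite mulmxA mxtrace_mulC.
by rewrite trT ?oppr0//; apply: brYT.
Qed.
End CartanNilpotent.

(** * Subsets of finite-dimensional spaces *)

Section FiniteDimension.
Variables (K : fieldType) (V : vectType K).

(** A [{vspace V}] of maximal dimension inside [S] is all of [S], since a missing vector could be
    adjoined. *)
Lemma vspace_of_subspace (S : set V) : linear_subspace S ->
  exists U : {vspace V}, forall v, S v <-> v \in U.
Proof.
move=> SS.
pose P := [pred d | `[< exists2 U : {vspace V}, forall v, v \in U ->
  S v & \dim U = d >]].
have exP : exists d, P d.
  exists 0%N; apply/asboolP; exists 0%VS; last exact: dimv0.
  by move=> v; rewrite memv0 => /eqP ->; apply: subspace0.
have ubP d : P d -> (d <= dim V)%N.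
  by move=> /asboolP[U _ <-]; rewrite -dimvf dimvS ?subvf.
have [d /asboolP[U US dU] maxd] := ex_maxnP exP ubP.
exists U => v; split=> [Sv|/US//]; apply/negPn/negP => vU.
have := maxd (\dim (U + <[v]>)%VS); rewrite leqNgt -dU ltn_neqAle.
have -> /= : (\dim U <= \dim (U + <[v]>))%N by rewrite dimvS ?addvSl.
have -> /= : (\dim U != \dim (U + <[v]>))%N.
  apply: contraNneq vU => dE; rewrite memvE.
  by rewrite (_ : U = U + <[v]>)%VS ?addvSr//; apply/eqP;
    rewrite eqEdim addvSl dE/=.
suff Pd : P (\dim (U + <[v]>)%VS) by move=> /(_ Pd).
apply/asboolP; exists (U + <[v]>)%VS => // _ /memv_addP[u uU [_ /vlineP[a ->]
  ->]].
by apply: subspaceD => //; [apply: US|apply: subspaceZ].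
Qed.

(** Again by maximal dimension. The list stays inside [X], so that each of its members keeps the
    extra data which [X] records, such as a word inducing a given matrix. *)
Lemma finite_spanning (X : set V) :
  exists2 s : seq V, forall v, v \in s -> X v & forall v, X v -> v \in <<s>>%VS.
Proof.
pose P := [pred d | `[< exists2 s : seq V, forall v, v \in s ->
  X v & \dim <<s>> = d >]].
have exP : exists d, P d by exists 0%N; apply/asboolP; exists [::];
  rewrite ?span_nil ?dimv0.
have ubP d : P d -> (d <= dim V)%N.
  by move=> /asboolP[U _ <-]; rewrite -dimvf dimvS ?subvf.
have [d /asboolP[s sX ds] maxd] := ex_maxnP exP ubP.
exists s => // v Xv; apply/negPn/negP => vU.
have := maxd (\dim <<v :: s>>%VS); rewrite leqNgt -ds ltn_neqAle.
have sS : (<<s>> <= <<v :: s>>)%VS by rewrite span_cons addvSr.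
have -> /= : (\dim <<s>> <= \dim <<v :: s>>)%N by rewrite dimvS.
have -> /= : (\dim <<s>> != \dim <<v :: s>>)%N.
  apply: contraNneq vU => dE.
  by rewrite (_ : <<s>> = <<v :: s>>)%VS ?memv_span ?mem_head//; apply/eqP;
    rewrite eqEdim sS dE/=.
suff Pd : P (\dim <<v :: s>>%VS) by move=> /(_ Pd).
by apply/asboolP; exists (v :: s) => // u; rewrite inE => /predU1P[->|/sX].
Qed.

End FiniteDimension.

(** * Engel's theorem *)

Section Engel.
Variables (F : fieldType) (n : nat).
Implicit Types (K S : set 'M[F]_n) (X Y Z : 'M[F]_n).

Fixpoint right_killed K (j : nat) X : Prop :=
  if j is j'.+1 then forall Y, K Y -> right_killed K j' (X *m Y) else X = 0.

Fixpoint left_killed K (j : nat) X : Prop :=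
  if j is j'.+1 then forall Y, K Y -> left_killed K j' (Y *m X) else X = 0.

(** Equivalently, the associative algebra without unit generated by [K] is nilpotent. In this form
    Engel's theorem needs no choice of a flag. *)
Definition nil_set K := exists N, right_killed K N 1%:M.

Lemma right_killed_subspace K j : linear_subspace (right_killed K j).
Proof.
elim: j => [|j IHj]; split=> //=.
- by move=> a u v -> ->; rewrite scaler0 addr0.
- by move=> Y KY; rewrite mul0mx; apply: subspace0.
- move=> a u v Hu Hv Y KY; rewrite mulmxDl -scalemxAl.
  by apply: IHj.2; [apply: Hu|apply: Hv].
Qed.

Lemma right_killedMl K j X Z : right_killed K j X -> right_killed K j (Z *m X).
Proof.
elim: j X => [X /= ->|j IHj X HX Y KY]; first by rewrite mulmx0.
by rewrite -mulmxA; apply/IHj/HX.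
Qed.

Lemma left_killedMr K j X Z : left_killed K j X -> left_killed K j (X *m Z).
Proof.
elim: j X => [X /= ->|j IHj X HX Y KY]; first by rewrite mul0mx.
by rewrite mulmxA; apply/IHj/HX.
Qed.

Lemma right_killedS K j X : right_killed K j X -> right_killed K j.+1 X.
Proof.
elim: j X => [X /= -> Y _|j IHj X HX Y KY]; first by rewrite mul0mx.
exact/IHj/HX.
Qed.

Lemma right_killed_all K N X : right_killed K N 1%:M -> right_killed K N X.
Proof. by move=> /(right_killedMl X); rewrite mulmx1. Qed.

(** A product of [N] members of [K] is the zero matrix; the two predicates only peel off its factors
    from opposite ends. *)
Lemma left_killed_all K N X : right_killed K N 1%:M -> left_killed K N X.
Proof.
move=> KN.
have rk j Y w : right_killed K j Y -> size w = j -> (forall Z, Z \in w ->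
  K Z) ->
    foldl mulmx Y w = 0.
  elim: j w Y => [[]// Y /= -> //|j IHj [//|Z w] Y YK [sw] wK /=].
  apply: IHj => // [|Z' wZ']; first by apply: YK; apply: wK; rewrite mem_head.
  by apply: wK; rewrite inE wZ' orbT.
have foldlE Z w : foldl mulmx Z w = Z *m foldl mulmx 1%:M w.
  elim: w Z => [|A w IHw] Z /=; first by rewrite mulmx1.
  by rewrite IHw [in RHS]IHw mul1mx mulmxA.
have foldrE Y w : foldr mulmx Y w = foldl mulmx 1%:M w *m Y.
  elim: w Y => [|A w IHw] Y /=; first by rewrite mul1mx.
  by rewrite IHw mul1mx [in RHS]foldlE !mulmxA.
have lk j Y : (forall w, size w = j -> (forall Z, Z \in w -> K Z) ->
    foldr mulmx Y w = 0) -> left_killed K j Y.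
  elim: j Y => [Y HY|j IHj Y HY Z KZ]; first exact: (HY [::]).
  apply: IHj => w sw wK.
  rewrite -foldr_rcons HY ?size_rcons ?sw// => Z'.
  by rewrite mem_rcons inE => /predU1P[->|/wK].
by apply: lk => w sw wK; rewrite foldrE (rk N) ?mul0mx.
Qed.

(** [ad K] is nilpotent on matrices: each bracket adds a factor from [K] on the left or on the
    right, so it lowers [filt] by one, and everything lies in level [N + N]. An element of [S]
    outside [K] of lowest level is sent into [K] by all of [ad K]. *)
Lemma normalizing_element K S : linear_subspace K -> linear_subspace S ->
  K `<=` S -> (forall X Y, S X -> S Y -> S (mxbr X Y)) -> nil_set K ->
  (exists2 Y, S Y & ~ K Y) ->
  exists Z, [/\ S Z, ~ K Z & forall X, K X -> K (mxbr X Z)].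
Proof.
move=> Ks Ss KS Sbr [N KN] [Y SY nKY].
apply: contrapT => nex.
pose filt m := linear_span [set X | exists i j,
  [/\ (i + j)%N = m, left_killed K i X & right_killed K j X]].
have fs m : linear_subspace (filt m) by exact: linear_span_subspace.
have filtS m : forall X, filt m.+1 X -> forall Z, K Z -> filt m (mxbr Z X).
  move=> X FX Z KZ.
  suff : filt m.+1 `<=` mxbr Z @^-1` (filt m) by exact.
  apply: linear_span_sub; first exact: preimage_subspace.
  move=> {FX}X [i [j [ijm LX RX]]]; apply: (subspaceB (fs m)).
    case: i ijm LX => [|i] ijm LX; first by rewrite /= in LX;
      rewrite LX mulmx0; exact: subspace0 (fs m).
    apply: sub_linear_span; exists i, j; split;
      [by case: ijm|exact: LX|exact: right_killedMl].
  case: j ijm RX => [|j] ijm RX; first by rewrite /= in RX; rewrite RX mul0mx;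
    exact: subspace0 (fs m).
  apply: sub_linear_span; exists i, j; split; [|exact: left_killedMr|exact: RX].
  by move: ijm; rewrite addnS => -[].
suff H m X : filt m X -> S X -> K X.
  apply: nKY; apply: (H (N + N)%N) => //; apply: sub_linear_span; exists N, N.
  by split=> //; [apply: left_killed_all|apply: right_killed_all].
elim: m X => [X|m IHm X FX SX].
  suff f0 : filt 0 `<=` [set 0] by move=> /f0 -> _; apply: subspace0.
  apply: linear_span_sub; first exact: zero_subspace.
  by move=> Z [[|i] [j []]].
apply: contrapT => nKX; apply: nex; exists X; split=> // Z KZ.
by apply: IHm; [exact: filtS|apply: Sbr => //; apply: KS].
Qed.

(** Moving [Z] past a letter of [K] costs only another letter of [K] in its place, so inserting [Z]
    into a word never reduces the effect of its letters from [K]. *)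
Lemma nil_set_extension K Z m : linear_subspace K -> nil_set K ->
  (forall X, K X -> K (mxbr X Z)) -> iter m (mulmx^~ Z) 1%:M = 0 ->
  nil_set [set X | exists2 Y, K Y & exists a, X = Y + a *: Z].
Proof.
move=> Ks [N KN] KZ Zm; set K' := [set X | _].
have rkZ j X : right_killed K j X -> right_killed K j (X *m Z).
  elim: j X => [X /= ->|j IHj X HX Y KY]; first by rewrite mul0mx.
  have -> : X *m Z *m Y = X *m Y *m Z - X *m mxbr Y Z.
    by rewrite /mxbr mulmxBr !mulmxA opprB addrCA subrr addr0.
  by apply: (subspaceB (right_killed_subspace K j)); [apply/IHj/HX|apply/HX/KZ].
have iterE i X : iter i (mulmx^~ Z) X = X *m iter i (mulmx^~ Z) 1%:M.
  by elim: i => [|i /= ->]; rewrite /= ?mulmx1 ?mulmxA.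
have rkI j i X : right_killed K j X -> right_killed K j (iter i (mulmx^~ Z) X).
  by move=> HX; elim: i => //= i; apply: rkZ.
(* A word of length [N * m] has [N] letters from [K] or, by the pigeonhole principle, a run of [m]
   letters [Z]. *)
exists (N * m)%N; elim: N (1%:M : 'M[F]_n) KN => [//|N IHN] X HX.
(* [A] collects the terms that have already used up a letter of [K]; the other summand is [B]
   followed by the current run of [m - i] letters [Z]. *)
suff H i A B : (i <= m)%N -> right_killed K N.+1 B -> right_killed K N A ->
    right_killed K' (i + N * m) (A + iter (m - i) (mulmx^~ Z) B).
  have := H m 0 X (leqnn m) HX (subspace0 (right_killed_subspace K N)).
  by rewrite add0r subnn mulSn.
elim: i A B => [|i IHi] A B im HB HA.
  by rewrite subn0 iterE Zm mulmx0 addr0; apply: IHN.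
move=> _ [Y KY [a ->]].
set W := iter (m - i.+1) _ B.
have WZ : W *m Z = iter (m - i) (mulmx^~ Z) B by rewrite /W -(subnSK im).
have -> : (A + W) *m (Y + a *: Z) =
    (A *m (Y + a *: Z) + W *m Y) + iter (m - i) (mulmx^~ Z) (a *: B).
  rewrite mulmxDl -!addrA; congr (_ + _); rewrite mulmxDr; congr (_ + _).
  rewrite -scalemxAr WZ.
  by elim: (m - i)%N => //= k <-; rewrite -scalemxAl.
have rs j := right_killed_subspace K j.
apply: IHi; [exact: ltnW|exact: (subspaceZ (rs N.+1))|].
apply: (subspaceD (rs N)); last by apply: (rkI N.+1).
rewrite mulmxDr -scalemxAr; apply: (subspaceD (rs N)).
  exact: (right_killedS HA).
exact/(subspaceZ (rs N))/rkZ.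
Qed.

(* A Lie subspace of maximal dimension among those with vanishing long
   products can be enlarged by an element normalizing it. *)
Theorem engel_jacobson S : linear_subspace S ->
  (forall X Y, S X -> S Y -> S (mxbr X Y)) ->
  (forall X, S X -> exists k, iter k (mulmx^~ X) 1%:M = 0) -> nil_set S.
Proof.
move=> Ss Sbr Snil.
pose P := [pred d | `[< exists U : {vspace 'M[F]_n}, [/\ forall X,
  X \in U -> S X,
  forall X Y, X \in U -> Y \in U -> mxbr X Y \in U,
  nil_set [set` U] & \dim U = d] >]].
have exP : exists d, P d.
  exists 0%N; apply/asboolP; exists 0%VS; split; last exact: dimv0.
  - by move=> X; rewrite memv0 => /eqP ->; apply: subspace0.
  - by move=> X Y; rewrite !memv0 => /eqP -> _;
    rewrite /mxbr mul0mx mulmx0 subrr.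
  - by exists 1%N => X /=; rewrite memv0 => /eqP ->; rewrite mulmx0.
have ubP d : P d -> (d <= dim 'M[F]_n)%N.
  by move=> /asboolP[U [_ _ _ <-]]; rewrite -dimvf dimvS ?subvf.
have [d /asboolP[U [US Ubr Unil dU]] maxd] := ex_maxnP exP ubP.
have Us : linear_subspace [set` U].
  by split=> [|a u v /= uU vU]; rewrite /= ?mem0v// memvD ?memvZ.
have [UeS|/existsNP[Y /not_implyP[SY nUY]]] := pselect (S `<=` [set` U]).
  suff <- : [set` U] = S by [].
  by apply/seteqP; split=> // X /US.
have [Z [SZ nUZ UZ]] := normalizing_element Us Ss US Sbr Unil
  (ex_intro2 _ _ Y SY nUY).
have [m Zm] := Snil Z SZ.
have := maxd (\dim (U + <[Z]>)%VS); rewrite leqNgt -dU ltn_neqAle.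
have -> /= : (\dim U <= \dim (U + <[Z]>))%N by rewrite dimvS ?addvSl.
have -> /= : (\dim U != \dim (U + <[Z]>))%N.
  apply: contra_notN nUZ => /eqP dE; rewrite /= memvE.
  by rewrite (_ : U = U + <[Z]>)%VS ?addvSr//; apply/eqP;
    rewrite eqEdim addvSl dE/=.
have UZ' X : X \in U -> mxbr X Z \in U by apply: UZ.
have memUZ X : X \in (U + <[Z]>)%VS <-> exists2 Y, Y \in U & exists a,
  X = Y + a *: Z.
  split=> [/memv_addP[u uU [_ /vlineP[a ->] ->]]|[u uU [a ->]]].
    by exists u => //; exists a.
  by rewrite memv_add// memvZ ?memv_line.
suff Pd : P (\dim (U + <[Z]>)%VS) by move=> /(_ Pd).
apply/asboolP; exists (U + <[Z]>)%VS; split=> //.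
- move=> X /memUZ[u uU [a ->]]; apply: subspaceD => //; first exact: US.
  exact: subspaceZ.
- move=> X X' /memUZ[u uU [a ->]] /memUZ[v vU [b ->]].
  have -> : mxbr (u + a *: Z) (v + b *: Z) = mxbr u v + b *: mxbr u Z - a *:
    mxbr v Z.
    have mxbrDr A X1 X2 c : mxbr A (X1 + c *: X2) = mxbr A X1 + c *: mxbr A X2.
      by rewrite addrC mxbr_is_linear addrC.
    have mxbrDl W : mxbr (u + a *: Z) W = mxbr u W - a *: mxbr W Z.
      by rewrite /mxbr mulmxDl mulmxDr -scalemxAl -scalemxAr opprD addrACA
        -scalerBr -scalerN opprB.
    by rewrite mxbrDr !mxbrDl [mxbr Z Z]subrr scaler0 subr0 addrAC.
  by apply: (subvP (addvSl U _)); apply: memvB; [apply: memvD;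
    [exact: Ubr|]|]; apply/memvZ/UZ'.
- have -> : [set` (U + <[Z]>)%VS] = [set X | exists2 Y, [set` U] Y & exists a,
  X = Y + a *: Z].
    by apply/seteqP; split=> X /memUZ.
  exact: (nil_set_extension Us Unil UZ Zm).
Qed.

End Engel.

(** * Cartan's criterion *)

Section LieBasics.
Variables (K : fieldType) (g : lieAlgType K).
Implicit Types (x y z : g) (S I J : set g).

HB.instance Definition _ x :=
  GRing.isLinear.Build K g g *:%R (bracket x) (fun a y z =>
    bracket_linearr a x y z).

Lemma bracketC x y : bracket x y = - bracket y x.
Proof.
have bDl z : bracket (x + y) z = bracket x z + bracket y z.
  by rewrite -[x in LHS]scale1r bracket_linearl scale1r.
apply/eqP; rewrite -addr_eq0; have := bracketxx (x + y).
by rewrite linearD/= !bDl !bracketxx add0r addr0 addrC => ->.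
Qed.

Lemma jacobi_right x y z :
  bracket x (bracket y z) = bracket (bracket x y) z - bracket (bracket x z) y.
Proof.
have := jacobi x y z; rewrite -addrA => /eqP; rewrite addr_eq0 => /eqP ->.
rewrite opprD addrC; congr (_ + _); first by rewrite [RHS]bracketC.
by rewrite [bracket (bracket x z) y]bracketC (bracketC z x) linearN.
Qed.

Lemma lie_derived_subspace S : linear_subspace (lie_derived S).
Proof. exact: linear_span_subspace. Qed.

Lemma mem_lie_derived S x y : S x -> S y -> lie_derived S (bracket x y).
Proof.
by move=> Sx Sy; exact: (sub_linear_span (ex_intro2 _ _ x Sx
  (ex_intro2 _ _ y Sy erefl))).
Qed.

Lemma lie_derived_min S J : linear_subspace J ->
  (forall x y, S x -> S y -> J (bracket x y)) -> lie_derived S `<=` J.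
Proof. by move=> Js SJ; apply: linear_span_sub => // _ [x Sx [y Sy <-]];
  apply: SJ. Qed.

Lemma lie_derived_mono I J : I `<=` J -> lie_derived I `<=` lie_derived J.
Proof.
move=> IJ; apply: lie_derived_min; first exact: lie_derived_subspace.
by move=> x y /IJ Jx /IJ Jy; apply: mem_lie_derived.
Qed.

Lemma iter_derived_sub m J : lie_subalgebra J ->
  iter m (@lie_derived K g) J `<=` J.
Proof.
move=> [Js Jbr]; elim: m => // m IHm; apply: subset_trans IHm.
elim: m => [|m IHm]; first exact: lie_derived_min.
exact: lie_derived_mono.
Qed.

Lemma iter_derived_subspace m J : linear_subspace J ->
  linear_subspace (iter m (@lie_derived K g) J).
Proof. by case: m => //= m _; apply: lie_derived_subspace. Qed.

Lemma solvableP I m : linear_subspace I ->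
  iter m (@lie_derived K g) I `<=` [set 0] -> lie_solvable I.
Proof.
move=> Is Im; exists m; apply/seteqP; split=> // _ ->.
exact: (subspace0 (iter_derived_subspace m Is)).
Qed.

End LieBasics.

Section CartanCriterion.
Variables (C : numClosedFieldType) (L : lieAlgType C) (n : nat).
Variable rho : {linear L -> 'M[C]_n}.
Hypothesis rho_br : forall x y, rho (bracket x y) = mxbr (rho x) (rho y).

Lemma trace_form_invariant x y z :
  \tr (rho (bracket x y) *m rho z) = \tr (rho x *m rho (bracket y z)).
Proof.
rewrite !rho_br /mxbr mulmxBl mulmxBr !raddfB/= -!mulmxA; congr (_ - _).
by rewrite mxtrace_mulC -mulmxA.
Qed.

Lemma trace_formC x y : \tr (rho x *m rho y) = \tr (rho y *m rho x).
Proof. exact: mxtrace_mulC. Qed.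

(** Commutators act by nilpotent matrices by [cartan_nilpotent], so Engel's theorem bounds the
    length of their nonzero products. As [rho] need not be faithful, the conclusion is solvability
    of the image. *)
Theorem cartan_criterion (J : set L) : lie_subalgebra J ->
  (forall x y, lie_derived J x -> J y -> \tr (rho x *m rho y) = 0) ->
  exists m, forall x, iter m (@lie_derived C L) J x -> rho x = 0.
Proof.
case: n rho rho_br => [|n'] f f_br.
  by move=> _ _; exists 0%N => x _; apply: flatmx0.
move=> Jsub trJ; have [Js Jbr] := Jsub.
pose T := f @` lie_derived J.
have TE : T = linear_span [set mxbr A B | A in f @` J & B in f @` J].
  rewrite /T /lie_derived -linear_span_image; congr linear_span.
  apply/seteqP; split.
    move=> _ [_ [x Jx [y Jy <-]] <-]; exists (f x); first by exists x.
    by exists (f y); [exists y|rewrite f_br].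
  move=> _ [_ [x Jx <-] [_ [y Jy <-] <-]]; exists (bracket x y) => //.
  by exists x => //; exists y.
have Ts : linear_subspace T by exact/image_subspace/lie_derived_subspace.
have DJ : lie_derived J `<=` J by apply: lie_derived_min.
have Tnil : nil_set T.
  apply: engel_jacobson => // [_ _ [x Dx <-] [y Dy <-]|X TX].
    by exists (bracket x y); [apply: mem_lie_derived; apply: DJ|rewrite f_br].
  exists n'.+1; have -> k : iter k (mulmx^~ X) 1%:M = X ^+ k.
    by elim: k => //= k ->; rewrite -[_ *m _]exprSr.
  apply: (@cartan_nilpotent _ _ (f @` J)); last by rewrite -TE.
  - exact: image_subspace.
  - by move=> _ _ [x Jx <-] [y Jy <-]; exists (bracket x y);
    [apply: Jbr|rewrite f_br].
  - by rewrite -TE => _ _ [x Dx <-] [y Jy <-]; apply: trJ.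
have [N TN] := Tnil; exists N.+1.
have D1 m : iter m.+1 (@lie_derived C L) J `<=` lie_derived J.
  by rewrite iterSr; apply: iter_derived_sub; split=> [|x y /DJ Jx /DJ Jy];
    [exact: lie_derived_subspace|exact: mem_lie_derived].
(* An element of the derived term of index [m.+1] counts for [m.+1] factors from [T]: in a bracket
   of two such elements, one contributes [m.+1] factors by induction and the other at least one. *)
suff H m x k Z : iter m.+1 (@lie_derived C L) J x ->
    right_killed T (k + m.+1) Z -> right_killed T k (Z *m f x).
  move=> x Dx; rewrite -[f x]mul1mx.
  by apply: (H N x 0%N 1%:M Dx); apply: right_killedS.
elim: m x k Z => [x k Z Dx|m IHm x k Z Dx].
  by rewrite addn1 => /(_ (f x)); apply; exists x.
rewrite addnS => HZ; move: x Dx.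
pose U := [set A | right_killed T k (Z *m A)].
have Us : linear_subspace U.
  have rs := right_killed_subspace T k.
  split=> [|a A B UA UB]; first by rewrite /U/= mulmx0; apply: subspace0 rs.
  by rewrite /U/= mulmxDr -scalemxAr; apply: rs.2.
suff H : iter m.+2 (@lie_derived C L) J `<=` f @^-1` U by exact: H.
have key x y : iter m.+1 (@lie_derived C L) J x ->
    iter m.+1 (@lie_derived C L) J y -> right_killed T k (Z *m (f x *m f y)).
  move=> Dx Dy; rewrite mulmxA; apply: (IHm x k.+1 Z Dx).
    by rewrite addSn.
  by exists y => //; apply: D1 Dy.
apply: lie_derived_min; first exact: preimage_subspace.
by move=> x y Dx Dy; rewrite /= f_br; apply: (subspaceB Us); apply: key.
Qed.

End CartanCriterion.

(** * Semisimple Lie algebras *)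

Section SemisimpleLie.
Variables (C : numClosedFieldType) (L : lieAlgType C) (d : nat).
Variables (phi : {linear 'rV[C]_d -> L}) (coo : {linear L -> 'rV[C]_d}).
Hypotheses (phiK : cancel phi coo) (cooK : cancel coo phi).
Hypothesis ss : semisimple [set: L].

(* Matrices act on row vectors from the right, so representations are right
   modules and the adjoint one is [v |-> [v, x]]. *)
Definition ad_fun (x : L) (v : 'rV[C]_d) := coo (bracket (phi v) x).

Lemma ad_fun_is_linear x : linear (ad_fun x).
Proof.
by move=> a u v; rewrite /ad_fun linearP bracket_linearl linearP.
Qed.
HB.instance Definition _ x :=
  GRing.isLinear.Build C 'rV[C]_d 'rV[C]_d *:%R (ad_fun x) (ad_fun_is_linear x).

Definition ad x : 'M[C]_d := lin1_mx (ad_fun x).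

Lemma adE v x : v *m ad x = coo (bracket (phi v) x).
Proof. by rewrite mul_rV_lin1. Qed.

Lemma ad_is_linear : linear ad.
Proof.
move=> a x y; apply/row_matrixP => i; rewrite !rowE adE.
by rewrite mulmxDr -scalemxAr !adE !linearP.
Qed.
HB.instance Definition _ := GRing.isLinear.Build C L 'M[C]_d *:%R ad
  ad_is_linear.

Lemma ad_br x y : ad (bracket x y) = mxbr (ad x) (ad y).
Proof.
apply/row_matrixP => i; rewrite !rowE adE /mxbr mulmxBr !mulmxA !adE !cooK.
by rewrite -linearB/= jacobi_right.
Qed.

Lemma lie_idealT (J : set L) : linear_subspace J ->
  (forall x y, J y -> J (bracket x y)) -> lie_ideal setT J.
Proof. by move=> Js Jbr; split=> // x y _; apply: Jbr. Qed.

Lemma solvable_ideal0 (J : set L) m : linear_subspace J ->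
  (forall x y, J y -> J (bracket x y)) ->
  iter m (@lie_derived C L) J `<=` [set 0] -> forall x, J x -> x = 0.
Proof.
by move=> Js Jbr Jm x; rewrite (ss (lie_idealT Js Jbr) (solvableP Js Jm)).
Qed.

(** The kernel of [ad] is the centre, an abelian ideal. *)
Lemma ad_eq0 x : ad x = 0 -> x = 0.
Proof.
have adP z : ad z = 0 <-> forall y, bracket y z = 0.
  split=> [z0 y|z0]; last first.
    by apply/row_matrixP => i; rewrite rowE adE z0 linear0 row0.
  by apply: (can_inj cooK); rewrite -[y]cooK -adE z0 mulmx0 linear0.
apply: (@solvable_ideal0 [set x | ad x = 0] 1) => {x}.
- by split=> [|a u v u0 v0]; rewrite /= ?linear0// linearP/= u0 v0 scaler0
  addr0.
- by move=> x y; rewrite /= ad_br => ->; rewrite /mxbr mulmx0 mul0mx subrr.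
- apply: lie_derived_min; first exact: zero_subspace.
  by move=> x y _ /adP y0; apply: y0.
Qed.

(** Cartan's criterion and faithfulness of [rho] on [J] make [J] a solvable ideal. *)
Lemma trace_ideal0 (J : set L) n (rho : {linear L -> 'M[C]_n}) :
  (forall x y, rho (bracket x y) = mxbr (rho x) (rho y)) ->
  linear_subspace J -> (forall x y, J y -> J (bracket x y)) ->
  (forall x, J x -> rho x = 0 -> x = 0) ->
  (forall x y, J x -> J y -> \tr (rho x *m rho y) = 0) -> forall x, J x ->
    x = 0.
Proof.
move=> rho_br Js Jbr rho0 trJ.
have Jsub : lie_subalgebra J by split=> // x y _; apply: Jbr.
have DJ : lie_derived J `<=` J by apply: (iter_derived_sub (m := 1)).
have [m Jm] := cartan_criterion rho_br Jsub (fun x y Dx Jy =>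
  trJ x y (DJ _ Dx) Jy).
apply: (@solvable_ideal0 J m) => // x Dx.
by apply: rho0; [apply: iter_derived_sub Dx|apply: Jm].
Qed.

Let kappa x y := \tr (ad x *m ad y).

Lemma killing_linearl a x y z : kappa (a *: x + y) z = a * kappa x z + kappa y
  z.
Proof. by rewrite /kappa linearP mulmxDl -scalemxAl mxtraceD mxtraceZ. Qed.

Lemma killing_invariant x y z : kappa (bracket x y) z = kappa x (bracket y z).
Proof. exact: (trace_form_invariant ad_br). Qed.

Lemma killing_bracketl x y z : kappa (bracket x y) z = - kappa y (bracket x z).
Proof.
rewrite bracketC -killing_invariant /kappa [ad (- _)]linearN mulNmx.
exact: (raddfN (@mxtrace C d)).
Qed.

(** The orthogonal is the kernel of [\dim W] linear forms, whence the bound by rank and nullity. *)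
Lemma killing_orthogonal (W : {vspace 'rV[C]_d}) :
  exists2 U : {vspace 'rV[C]_d},
    forall v, v \in U <-> (forall w, w \in W -> kappa (phi v) (phi w) = 0) &
    (d <= \dim U + \dim W)%N.
Proof.
pose f (v : 'rV[C]_d) : 'rV[C]_(\dim W) :=
  \row_i kappa (phi v) (phi (vbasis W)`_i).
have f_lin : linear f.
  by move=> a u v; apply/rowP => i; rewrite !mxE linearP killing_linearl.
pose fL : {linear 'rV[C]_d -> 'rV[C]_(\dim W)} := linear_of f_lin.
exists (lker (linfun fL)) => [v|].
  rewrite memv_ker lfunE/=; split=> [/eqP fv w wW|fv].
    rewrite (coord_vbasis wW) !linear_sum/= /kappa trace_formC !linear_sum.
    rewrite mulmx_suml raddf_sum/= big1 // => i _.
    rewrite !linearZ/= -scalemxAl mxtraceZ mxtrace_mulC.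
    have /rowP/(_ i) := fv; rewrite !mxE /kappa => ->.
    by rewrite mulr0.
  by apply/eqP/rowP => i; rewrite !mxE fv// vbasis_mem// mem_nth// size_tuple.
have := limg_ker_dim (linfun fL) fullv; rewrite capfv dimvf /dim/= mul1n => dE.
rewrite -[X in (X <= _)%N]dE leq_add2l; apply: leq_trans (dimvS (subvf _)) _.
by rewrite dimvf /dim/= mul1n.
Qed.

Lemma killing_nondegenerate x : (forall y, kappa x y = 0) -> x = 0.
Proof.
apply: (@trace_ideal0 [set x | forall y, kappa x y = 0] _ ad) => {x} //.
- exact: ad_br.
- split=> [y|a u v u0 v0 y]; first by rewrite /kappa linear0 mul0mx mxtrace0.
  by rewrite killing_linearl u0 v0 mulr0 addr0.
- by move=> x y y0 z; rewrite /= killing_bracketl y0 oppr0.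
- by move=> x _; exact: ad_eq0.
- by move=> x y x0 _; apply: x0.
Qed.

(** By invariance, an element orthogonal to all brackets has brackets orthogonal to everything, so
    it is central, hence zero. The brackets then span by dimension count. *)
Lemma semisimple_perfect (V : lmodType C) (f : {linear L -> V}) :
  (forall x y, f (bracket x y) = 0) -> forall x, f x = 0.
Proof.
move=> f0 x.
have [W WP] := vspace_of_subspace (preimage_subspace phi (linear_span_subspace
  [set bracket y z | y in setT & z in setT])).
have brW y z : coo (bracket y z) \in W.
  by apply/WP; rewrite /= cooK; apply: mem_lie_derived.
have [U UP dU] := killing_orthogonal W.
have U0 : (U <= 0)%VS.
  apply/subvP => v /UP v0; rewrite memv0; apply/eqP/(can_inj phiK);
    rewrite linear0.
  apply: ad_eq0; apply/row_matrixP => i; rewrite rowE adE row0.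
  rewrite -[RHS](linear0 coo); congr (coo _).
  rewrite bracketC; apply/eqP; rewrite oppr_eq0; apply/eqP.
  apply: killing_nondegenerate => z.
  by rewrite killing_invariant -[bracket _ z]cooK v0.
have WT : W = fullv.
  apply/eqP; rewrite eqEdim subvf dimvf /dim/= mul1n.
  by move: U0 dU; rewrite subv0 => /eqP ->; rewrite dimv0.
have : coo x \in W by rewrite WT memvf.
move=> /WP; rewrite /= cooK.
suff H : lie_derived setT `<=` [set x | f x = 0] by exact: H.
apply: lie_derived_min => [|y z _ _]; last exact: f0.
by split=> [|a u v /= u0 v0]; rewrite /= ?linear0// linearP u0 v0 scaler0 addr0.
Qed.

(* [u] is a basis of the Killing orthogonal of the kernel of [rho]. *)
Theorem casimir_basis n (rho : {linear L -> 'M[C]_n}) :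
  (forall x y, rho (bracket x y) = mxbr (rho x) (rho y)) ->
  exists r (u : 'I_r -> L),
  [/\ (\matrix_(i, j) \tr (rho (u i) *m rho (u j))) \in unitmx,
      forall x i, exists A : 'I_r -> C, bracket (u i) x = \sum_j A j *: u j
    & r = 0%N -> forall x, rho x = 0].
Proof.
move=> rho_br.
have [K KP] : exists K : {vspace 'rV[C]_d}, forall v,
  rho (phi v) = 0 <-> v \in K.
  apply: (@vspace_of_subspace _ _ [set v | rho (phi v) = 0]).
  split=> [|a u v /= u0 v0]; first by rewrite /= !linear0.
  by rewrite !linearP u0 v0 scaler0 addr0.
have [J JP dJ] := killing_orthogonal K.
have Kid x v : v \in K -> coo (bracket x (phi v)) \in K.
  by move=> /KP v0; apply/KP; rewrite cooK rho_br v0 /mxbr mulmx0 mul0mx subrr.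
have Jid x v : v \in J -> coo (bracket x (phi v)) \in J.
  move=> /JP v0; apply/JP => w wK; rewrite cooK.
  by rewrite killing_bracketl -[bracket x _]cooK v0 ?Kid// oppr0.
have phiS (U : {vspace 'rV[C]_d}) : linear_subspace [set x | coo x \in U].
  by split=> [|a u v /= uU vU]; rewrite /= ?linear0 ?mem0v// linearP memvD
    ?memvZ.
(* The intersection is an ideal on which the Killing form vanishes. *)
have JK0 : (J :&: K = 0)%VS.
  apply/eqP; rewrite -subv0; apply/subvP => v; rewrite memv0 => vJK.
  apply/eqP/(can_inj phiK); rewrite linear0; move: (phi v) (phiK v) vJK => x <-.
  apply: (@trace_ideal0 [set x | coo x \in (J :&: K)%VS] _ ad) => {v x}.
  - exact: ad_br.
  - exact: phiS.
  - move=> x y; rewrite /= !memv_cap => /andP[yJ yK].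
    by rewrite -[y]cooK Jid// Kid.
  - by move=> x _; apply: ad_eq0.
  - move=> x y; rewrite /= !memv_cap => /andP[/JP xJ _] /andP[_ yK].
    by rewrite -[x]cooK -[y]cooK; apply: xJ.
have JKT : (J + K)%VS = fullv.
  apply/eqP; rewrite eqEdim subvf dimvf /dim/= mul1n.
  by have := dimv_sum_cap J K; rewrite JK0 dimv0 addn0 => ->.
(* The radical in [J] of the trace form of [rho] is an ideal, and [rho] is faithful on it because
   its kernel [K] meets [J] trivially. *)
have Jnd x : coo x \in J -> (forall y, coo y \in J ->
  \tr (rho x *m rho y) = 0) -> x = 0.
  move=> xJ x0.
  apply: (@trace_ideal0 [set x | coo x \in J /\
    forall y, coo y \in J -> \tr (rho x *m rho y) = 0] _ rho) => // {x xJ x0}.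
  - split=> [|a u v [uJ u0] [vJ v0]].
      by split=> [|y _]; rewrite linear0 ?mem0v// mul0mx mxtrace0.
    split; first exact: (phiS J).2.
    by move=> y yJ; rewrite linearP mulmxDl mxtraceD -scalemxAl mxtraceZ u0//
      v0// mulr0 addr0.
  - move=> x y [yJ y0]; split; first by rewrite -[y]cooK Jid.
    move=> z zJ; rewrite bracketC linearN mulNmx raddfN/=
      trace_form_invariant//.
    by rewrite y0 ?oppr0// -[z]cooK Jid.
  - move=> x [xJ _] x0.
    have xK : coo x \in K by apply/KP; rewrite cooK.
    have : coo x \in (J :&: K)%VS by rewrite memv_cap xJ.
    by rewrite JK0 memv0 => /eqP c0; rewrite -[x]cooK c0 linear0.
  - by move=> x y [xJ x0] [yJ _]; apply: x0.
pose b := vbasis J; pose u (i : 'I_(\dim J)) := phi b`_i.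
have uJ x : coo x \in J -> exists A : 'I_(\dim J) -> C, x = \sum_j A j *: u j.
  move=> xJ; exists (fun j => coord b j (coo x)).
  rewrite -{1}[x]cooK {1}(coord_vbasis xJ) linear_sum; apply: eq_bigr => j _.
  by rewrite linearZ.
have uiJ i : coo (u i) \in J by rewrite phiK vbasis_mem// mem_nth// size_tuple.
exists (\dim J), u; split=> [|x i|].
- rewrite -row_free_unit -kermx_eq0; apply/rowV0P => v /sub_kermxP vG.
  have trE j : \tr (rho (\sum_i v 0 i *: u i) *m rho (u j)) = 0.
    have /rowP/(_ j) := vG; rewrite !mxE => <-.
    rewrite linear_sum mulmx_suml raddf_sum; apply: eq_bigr => i _.
    by rewrite linearZ/= -scalemxAl mxtraceZ !mxE.
  have coou : coo (\sum_i v 0 i *: u i) = \sum_i v 0 i *: b`_i.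
    by rewrite linear_sum; apply: eq_bigr => i _; rewrite linearZ/= phiK.
  have x0 : \sum_i v 0 i *: u i = 0.
    apply: Jnd => [|y yJ].
      by rewrite coou memv_suml// => i _; rewrite memvZ//; have := uiJ i;
        rewrite phiK.
    have [A ->] := uJ y yJ.
    rewrite [rho (\sum_j A j *: _)]linear_sum mulmx_sumr raddf_sum big1//= => j
      _.
    by rewrite [rho (A j *: _)]linearZ/= -scalemxAr mxtraceZ trE mulr0.
  apply/rowP => i; rewrite mxE.
  move: coou; rewrite x0 linear0 => /esym.
  by move/freeP: (basis_free (vbasisP J)) => /(_ (v 0)) H /H; apply.
- by apply: uJ; rewrite bracketC linearN memvN Jid//; have := uiJ i;
  rewrite phiK.
- move=> /eqP; rewrite dimv_eq0 => /eqP J0 x; rewrite -[x]cooK; apply/KP.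
  by move: JKT; rewrite J0 add0v => ->; apply: memvf.
Qed.

End SemisimpleLie.

(** * Whitehead's lemma and Weyl's theorem *)

(** With [q] taking the conjugate of [d i ^+ k] at each eigenvalue [d i], the trace of [A ^+ k]
    times [q] at [A] is the sum of the squared moduli of the [d i ^+ k]. It vanishes, hence so does
    each eigenvalue. *)
Lemma nilpotent_trace (C : numClosedFieldType) n (A : 'M[C]_n.+1) k :
  A ^+ k = 0 -> \tr A = 0.
Proof.
move=> Ak; have [d _ trA] := triangularization A.
have us := undup_uniq [seq d i | i <- enum 'I_n.+1].
have [q Hq] := poly_interpolation 1 (fun c : C => (c ^+ k)^*) us.
have qd i : q.[d i] = (d i ^+ k)^*.
  have /dvdpP[r rE] : ('X - (d i)%:P) ^+ 1 %| q - ((d i ^+ k)^*)%:P.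
    by apply: Hq; rewrite mem_undup map_f ?mem_enum.
  rewrite -[q](subrK ((d i ^+ k)^*)%:P) rE !hornerE.
  by rewrite subrr mulr0 add0r.
have d0 i : d i = 0.
  have := trA ('X^k * q); rewrite rmorphM rmorphXn/= horner_mx_X Ak mul0r
    mxtrace0.
  move=> /esym/eqP; rewrite (eq_bigr (fun i => `|d i ^+ k| ^+ 2)) => [|j _];
    last first.
    by rewrite hornerM hornerXn qd normCK.
  rewrite psumr_eq0 => [/allP/(_ i (mem_index_enum _))|j _];
    last by rewrite exprn_ge0.
  by rewrite /= expf_eq0/= normr_eq0 expf_eq0 => /andP[_ /eqP].
rewrite -[A](horner_mx_X A) trA big1// => i _.
by rewrite hornerX d0.
Qed.

(** Invariance of the Casimir tensor: [A] is the matrix of bracketing with some [x] in a basis [u],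
    and [P] is the inverse of an invariant form. [b i j] stands for any bilinear expression in [u i]
    and [u j]. *)
Lemma casimir_sum (K : fieldType) (V : lmodType K) r (b : 'I_r -> 'I_r -> V)
    (P A : 'M[K]_r) : A^T *m P + P *m A = 0 ->
  \sum_i \sum_j P i j *: (\sum_k A i k *: b k j + \sum_k A j k *: b i k) = 0.
Proof.
move=> PA0.
transitivity (\sum_k \sum_l (A^T *m P + P *m A) k l *: b k l); last first.
  by rewrite PA0 big1// => i _; rewrite big1// => j _; rewrite mxE scale0r.
under [RHS]eq_bigr do under eq_bigr do rewrite !mxE scalerDl !scaler_suml.
under [RHS]eq_bigr do rewrite big_split/=.
under [LHS]eq_bigr do under eq_bigr do rewrite scalerDr !scaler_sumr.
under [LHS]eq_bigr do rewrite big_split/=.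
rewrite !big_split/=; congr (_ + _).
  rewrite exchange_big/= [RHS]exchange_big/=; apply: eq_bigr => j _.
  rewrite exchange_big/=; apply: eq_bigr => k _; apply: eq_bigr => i _.
  by rewrite mxE scalerA mulrC.
apply: eq_bigr => i _; rewrite exchange_big/=; apply: eq_bigr => k _.
by apply: eq_bigr => j _; rewrite scalerA.
Qed.

Section Whitehead.
Variables (C : numClosedFieldType) (L : lieAlgType C).

Definition representation n (rho : {linear L -> 'M[C]_n}) :=
  forall x y, rho (bracket x y) = mxbr (rho x) (rho y).

Definition cocycle n (rho : {linear L -> 'M[C]_n}) (f : {linear L ->
  'rV[C]_n}) :=
  forall x y, f (bracket x y) = f x *m rho y - f y *m rho x.

Definition vanishing_H1 n := forall (rho : {linear L ->
  'M[C]_n}) (f : {linear L -> 'rV[C]_n}),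
  representation rho -> cocycle rho f -> exists w, forall x, f x = w *m rho x.

(** The rows of [B] are a basis of a submodule containing all values of [f]. In these coordinates
    [f] is a cocycle in dimension [m]. *)
Lemma cocycle_restrict m n (B : 'M[C]_(m, n)) (rho : {linear L -> 'M[C]_n})
    (f : {linear L -> 'rV[C]_n}) : vanishing_H1 m -> row_free B ->
  representation rho -> cocycle rho f -> (forall x, stablemx B (rho x)) ->
  (forall x, f x <= B)%MS -> exists w, forall x, f x = w *m B *m rho x.
Proof.
move=> H1 Bfree rho_br fco Bst fB.
have [rho' rho'E] : exists rho' : {linear L ->
  'M[C]_m}, forall x, rho' x *m B = B *m rho x.
  by exists (mulmxr (pinvmx B) \o (mulmx B \o rho)) => x;
    rewrite /= mulmxKpV// Bst.
have [f' f'E] : exists f' : {linear L -> 'rV[C]_m}, forall x, f x = f' x *m B.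
  by exists (mulmxr (pinvmx B) \o f) => x; rewrite /= mulmxKpV.
have [|x y|w wE] := H1 rho' f'.
- move=> x y; apply: (row_free_inj Bfree); rewrite rho'E rho_br /mxbr.
  by rewrite mulmxBl mulmxBr -!(mulmxA (rho' _)) !rho'E !mulmxA !rho'E.
- apply: (row_free_inj Bfree); rewrite -f'E fco mulmxBl.
  by rewrite -!(mulmxA (f' _)) !rho'E !mulmxA -!f'E.
- by exists w => x; rewrite f'E wE -!mulmxA rho'E.
Qed.

Variables (d : nat) (phi : {linear 'rV[C]_d -> L}) (coo : {linear L ->
  'rV[C]_d}).
Hypotheses (phiK : cancel phi coo) (cooK : cancel coo phi).
Hypothesis ss : semisimple [set: L].

(* The Casimir element [Om] of [rho] makes [f *m Om] a coboundary. By Fitting,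
   it remains to treat the kernel of a power of [Om], a smaller module because
   [\tr Om = r] is not zero. *)
Theorem whitehead n : vanishing_H1 n.
Proof.
have [N] := ubnP n; elim: N n => // N IHN [|n] nN rho f rho_br fco.
  by exists 0 => x; rewrite [f x]thinmx0 thinmx0.
have [r [u [Gu uA r0]]] := casimir_basis phiK cooK ss rho_br.
(* If [r] is zero, the action is trivial, so the cocycle kills all brackets and vanishes by
   perfectness. *)
have [r_eq0|r_neq0] := eqVneq r 0%N.
  exists 0 => x; rewrite mul0mx.
  apply: (semisimple_perfect phiK cooK ss) => y z.
  by rewrite fco !r0// !mulmx0 subrr.
move: Gu; set G := \matrix_(i, j) _ => Gu; set P := invmx G.
have {}uA x : exists A : 'M[C]_r, forall i,
  bracket (u i) x = \sum_j A i j *: u j.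
  have /choice[A HA] := uA x.
  by exists (\matrix_(i, j) A i j) => i; rewrite HA; apply: eq_bigr => j _;
    rewrite mxE.
have Gsym : G^T = G by apply/matrixP => i j; rewrite !mxE mxtrace_mulC.
(* Invariance of the trace form reads [A *m G + G *m A^T = 0]; multiplying by [P] on both sides
   gives the hypothesis of [casimir_sum]. *)
have PA x (A : 'M[C]_r) : (forall i, bracket (u i) x = \sum_j A i j *: u j) ->
    A^T *m P + P *m A = 0.
  move=> HA.
  have AG : A *m G + G *m A^T = 0.
    apply/matrixP => i j; rewrite !mxE.
    have -> : \sum_k A i k * G k j = \tr (rho (bracket (u i) x) *m rho (u j)).
      rewrite HA (raddf_sum rho) mulmx_suml raddf_sum; apply: eq_bigr => k _.
      by rewrite /= linearZ -scalemxAl mxtraceZ mxE.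
    have -> : \sum_k G i k * A^T k j = \tr (rho (u i) *m rho (bracket (u j) x)).
      rewrite HA (raddf_sum rho) mulmx_sumr raddf_sum; apply: eq_bigr => k _.
      by rewrite /= [rho (_ *: _)]linearZ -scalemxAr mxtraceZ !mxE mulrC.
    rewrite (trace_form_invariant rho_br) (bracketC x) [rho
      (- _)]linearN mulmxN.
    by rewrite raddfN/= addNr.
  have -> : A^T *m P + P *m A = P *m (A *m G + G *m A^T) *m P.
    rewrite mulmxDr mulmxDl !mulmxA mulVmx// mul1mx addrC.
    by rewrite -!mulmxA mulmxV// mulmx1.
  by rewrite AG mulmx0 mul0mx.
(* The same tensor is evaluated with [rho] in both places, and with [f] in the first. Its invariance
   yields [OmC] and, through the cocycle rule, [w1E]. *)
pose Om := \sum_i \sum_j P i j *: (rho (u i) *m rho (u j)).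
pose w1 := \sum_i \sum_j P i j *: (f (u i) *m rho (u j)).
have OmC x : Om *m rho x = rho x *m Om.
  have [A HA] := uA x.
  apply/eqP; rewrite -subr_eq0 -(casimir_sum (fun i j =>
    rho (u i) *m rho (u j)) (PA x A HA)).
  rewrite mulmx_suml mulmx_sumr -sumrB; apply/eqP/eq_bigr => i _.
  rewrite mulmx_suml mulmx_sumr -sumrB; apply/eq_bigr => j _.
  rewrite -scalemxAl -scalemxAr -scalerBr; congr (_ *: _).
  have -> : \sum_k A i k *: (rho (u k) *m rho (u j)) = rho (bracket
    (u i) x) *m rho (u j).
    by rewrite HA (raddf_sum rho) mulmx_suml; apply: eq_bigr => k _;
      rewrite /= linearZ -scalemxAl.
  have -> : \sum_k A j k *: (rho (u i) *m rho (u k)) = rho (u i) *m rho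
    (bracket (u j) x).
    by rewrite HA (raddf_sum rho) mulmx_sumr; apply: eq_bigr => k _;
      rewrite /= linearZ -scalemxAr.
  rewrite !rho_br /mxbr mulmxBl mulmxBr !mulmxA [RHS]addrC.
  by rewrite addrA subrK.
have OmX k x : Om ^+ k *m rho x = rho x *m Om ^+ k.
  elim: k => [|k IHk]; first by rewrite expr0 mulmx1 mul1mx.
  by rewrite exprS -[_ * _]/(_ *m _) -mulmxA IHk !mulmxA OmC.
have w1E x : f x *m Om = w1 *m rho x.
  have [A HA] := uA x.
  apply/eqP; rewrite eq_sym -subr_eq0 -(casimir_sum (fun i j =>
    f (u i) *m rho (u j)) (PA x A HA)).
  rewrite mulmx_suml mulmx_sumr -sumrB; apply/eqP/eq_bigr => i _.
  rewrite mulmx_suml mulmx_sumr -sumrB; apply/eq_bigr => j _.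
  rewrite -scalemxAl -scalemxAr -scalerBr; congr (_ *: _).
  have -> : \sum_k A i k *: (f (u k) *m rho (u j)) = f (bracket
    (u i) x) *m rho (u j).
    by rewrite HA (raddf_sum f) mulmx_suml; apply: eq_bigr => k _;
      rewrite /= linearZ -scalemxAl.
  have -> : \sum_k A j k *: (f (u i) *m rho (u k)) = f (u i) *m rho (bracket
    (u j) x).
    by rewrite HA (raddf_sum rho) mulmx_sumr; apply: eq_bigr => k _;
      rewrite /= linearZ -scalemxAr.
  rewrite fco rho_br /mxbr mulmxBl mulmxBr !mulmxA [RHS]addrC.
  by rewrite addrA subrK.
have trOm : \tr Om = r%:R.
  transitivity (\tr (P *m G^T)).
    rewrite raddf_sum; apply: eq_bigr => i _; rewrite mxE raddf_sum.
    by apply: eq_bigr => j _; rewrite /= mxtraceZ !mxE mxtrace_mulC.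
  by rewrite Gsym mulVmx// mxtrace1.
(* Fitting decomposition: [h] is the part of the characteristic polynomial prime to ['X]. By Bezout,
   [e] projects onto the kernel of [Om ^+ m], and [aO] inverts [Om] on the complement. *)
have [m [h h0 hE]] := multiplicity_XsubC (char_poly Om) 0.
move: h0; rewrite monic_neq0 ?char_poly_monic//= => h0.
have /Bezout_eq1_coprimepP[[a b] /= ab1] : coprimep 'X h.
  by rewrite coprimep_sym -['X]subr0 -polyC0 coprimep_XsubC.
pose e := horner_mx Om (b * h); pose aO := horner_mx Om a.
have eOm : e *m Om ^+ m = 0.
  rewrite -[Om in Om ^+ _](horner_mx_X Om) -rmorphXn -[_ *m _]rmorphM/= -mulrA.
  by rewrite -['X]subr0 -polyC0 -hE rmorphM/= Cayley_Hamilton mulr0.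
have aOe : Om *m aO + e = 1%:M.
  rewrite -[Om in LHS](horner_mx_X Om) -[_ *m _]rmorphM -rmorphD/=.
  by rewrite mulrC ab1 rmorph1.
have eC x : e *m rho x = rho x *m e by
  apply/comm_mx_sym/comm_mx_horner/esym/OmC.
have aC x : aO *m rho x = rho x *m aO by
  apply/comm_mx_sym/comm_mx_horner/esym/OmC.
pose B := row_base (kermx (Om ^+ m)).
have rankB : (\rank (kermx (Om ^+ m)) < N)%N.
  rewrite -ltnS; apply: leq_trans nN; rewrite ltnS ltn_neqAle rank_leq_row
    andbT.
  rewrite mxrank_ker; apply: contra_neq r_neq0 => rk.
  have Omm : Om ^+ m = 0.
    apply/eqP; rewrite -mxrank_eq0.
    by rewrite -[X in X == _](subKn (rank_leq_row (Om ^+ m))) rk subnn.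
  by apply/eqP; rewrite -(pnatr_eq0 C) -trOm (nilpotent_trace Omm).
pose fe : {linear L -> 'rV[C]_n.+1} := mulmxr e \o f.
have [||||||w0 w0E] := @cocycle_restrict _ _ B rho fe.
- exact: IHN.
- exact: row_base_free.
- by [].
- move=> x y; rewrite /= fco mulmxBl.
  by rewrite -!mulmxA -!eC.
- move=> x; rewrite stablemx_row_base; apply/sub_kermxP.
  by rewrite -mulmxA -OmX mulmxA mulmx_ker mul0mx.
- by move=> x; rewrite eq_row_base; apply/sub_kermxP;
  rewrite /= -mulmxA eOm mulmx0.
(* Split [f] as [f *m e + f *m Om *m aO]: the first summand is handled by induction, the second by
   [w1E]. *)
exists (w0 *m B + w1 *m aO) => x.
rewrite -[LHS]mulmx1 -aOe addrC mulmxDr -[f x *m e]/(fe x) w0E mulmxDl;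
  congr (_ + _).
by rewrite mulmxA w1E -!mulmxA aC.
Qed.

End Whitehead.

Section WeylMatrix.
Variables (C : numClosedFieldType) (L : lieAlgType C).
Variables (d : nat) (phi : {linear 'rV[C]_d -> L}) (coo : {linear L ->
  'rV[C]_d}).
Hypotheses (phiK : cancel phi coo) (cooK : cancel coo phi).
Hypothesis ss : semisimple [set: L].

(** For any projection [q] onto [W], the commutators [mxbr q (rho x)] form a cocycle with values in
    the matrices that map into [W] and kill [W]. It is the coboundary of such a matrix, and
    subtracting that matrix from [q] leaves a projection which commutes with [rho]. *)
Theorem weyl_matrix n (rho : {linear L -> 'M[C]_n}) (W : 'M[C]_n) :
  representation rho -> (forall x, stablemx W (rho x)) ->
  exists p : 'M[C]_n, [/\ (p <= W)%MS, W *m p = W & forall x,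
    p *m rho x = rho x *m p].
Proof.
move=> rho_br Wst.
have [sg sgE] : exists sg : {linear L -> 'M[C]_(n * n)},
    forall x u, u *m sg x = mxvec (mxbr (vec_mx u) (rho x)).
  exists ((lin_mulmxr \o rho) \- (lin_mulmx \o rho)) => x u.
  by rewrite /= mulmxBr !mul_rV_lin/= linearB.
have sg_br : representation sg.
  move=> x y; apply/row_matrixP => i; rewrite !rowE /mxbr mulmxBr !mulmxA !sgE
    !mxvecK.
  rewrite -linearB/= rho_br /mxbr; congr mxvec.
  set A := vec_mx _; set X := rho x; set Y := rho y.
  rewrite !mulmxBl !mulmxBr !mulmxA.
  move: (A *m X *m Y) (X *m A *m Y) (Y *m A *m X) (Y *m X *m A) (A *m Y *m X)
    (X *m Y *m A).
  by move=> a b c e f h; apply/matrixP => i' j; rewrite !mxE; ring.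
pose q := pinvmx W *m W.
have qW : (q <= W)%MS by rewrite submxMl.
have Wq : W *m q = W by rewrite /q mulmxA mulmxKpV.
(* Matrices are flattened by [mxvec], so this encodes the maps into [W] that vanish on [W]. *)
pose V := (kermx (lin_mx (mulmxr (cokermx W))) :&: kermx (lin_mx (mulmx W)))%MS.
have VP u : reflect ((vec_mx u <= W)%MS /\ W *m vec_mx u = 0) (u <= V)%MS.
  rewrite sub_capmx; apply: (iffP andP).
    move=> [/sub_kermxP + /sub_kermxP].
    rewrite !mul_rV_lin/= => /(congr1 vec_mx) + /(congr1 vec_mx).
    by rewrite !mxvecK linear0 submxE => -> ->.
  move=> []; rewrite submxE => /eqP u0 u1.
  by split; apply/sub_kermxP; rewrite mul_rV_lin/= ?u0 ?u1 linear0.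
have Vst x : stablemx V (sg x).
  apply/row_subP => i; rewrite row_mul sgE;
    move: (row i V) (row_sub i V) => u /VP[uW Wu].
  apply/VP; rewrite mxvecK /mxbr; split.
    rewrite addmx_sub//; first by rewrite (submx_trans _ (Wst x))// submxMr.
    by rewrite eqmx_opp (submx_trans _ uW)// submxMl.
  rewrite mulmxBr mulmxA Wu mul0mx sub0r mulmxA.
  by have /submxP[D ->] := Wst x; rewrite -mulmxA Wu mulmx0 oppr0.
have fV x : (mxvec q *m sg x <= V)%MS.
  apply/VP; rewrite sgE !mxvecK /mxbr; split.
    rewrite addmx_sub//; first by rewrite (submx_trans _ (Wst x))// submxMr.
    by rewrite eqmx_opp (submx_trans _ qW)// submxMl.
  rewrite mulmxBr mulmxA Wq mulmxA.
  by have /submxP[D ->] := Wst x; rewrite -mulmxA Wq subrr.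
have [||||||w wE] := @cocycle_restrict _ _ _ _ (row_base V) sg (mulmx
  (mxvec q) \o sg).
- exact: (whitehead phiK cooK ss).
- exact: row_base_free.
- exact: sg_br.
- by move=> x y; rewrite /= sg_br /mxbr mulmxBr !mulmxA.
- by move=> x; rewrite stablemx_row_base.
- by move=> x; rewrite eq_row_base; apply: fV.
have /VP[wW Ww] : (w *m row_base V <= V)%MS.
  by rewrite (submx_trans (submxMl _ _))// eq_row_base.
exists (q - vec_mx (w *m row_base V)); split=> [||x].
- by rewrite addmx_sub ?eqmx_opp.
- by rewrite mulmxBr Wq Ww subr0.
have := wE x; rewrite /= !sgE => /(can_inj mxvecK).
rewrite !mxvecK /mxbr => /eqP.
rewrite subr_eq mulmxBl mulmxBr => /eqP ->.
by rewrite addrAC [_ *m rho x - _]addrC addrK addrC.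
Qed.
End WeylMatrix.

(** * Subspaces as vector spaces *)

Section SubspaceType.
Variables (K : fieldType) (V : lmodType K).

(** The closure proof is an argument so that the submodule structure can be recovered from the
    predicate. *)
Definition subspace_pred (S : set V) (SS : linear_subspace S) : {pred V} :=
  fun v => `[< S v >].

Section Instances.
Variables (S : set V) (SS : linear_subspace S).

Lemma subspace_pred_closed : submod_closed (subspace_pred SS).
Proof.
split; first exact/asboolP/(subspace0 SS).
by move=> a u v /asboolP Su /asboolP Sv; apply/asboolP/SS.2.
Qed.
HB.instance Definition _ := GRing.isSubmodClosed.Build K V (subspace_pred SS)
  subspace_pred_closed.

Record subspace_type := SubspaceElem {
  subspace_val : V; subspace_valP : subspace_pred SS subspace_val }.
HB.instance Definition _ := [isSub for subspace_val].
HB.instance Definition _ := [Choice of subspace_type by <:].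
HB.instance Definition _ := [SubChoice_isSubLmodule of subspace_type by <:].

Lemma in_subspace (u : subspace_type) : S (val u).
Proof. by apply/asboolP; case: u. Qed.

Definition to_subspace v (Sv : S v) : subspace_type :=
  SubspaceElem (asboolT Sv).

End Instances.
End SubspaceType.

(** * Subalgebras as Lie algebras *)

Section SubLie.
Variables (K : fieldType) (g : lieAlgType K) (S : set g)
  (SS : lie_subalgebra S).

Definition lie_subtype := subspace_type SS.1.
HB.instance Definition _ := GRing.Lmodule.on lie_subtype.

Definition sub_bracket (x y : lie_subtype) : lie_subtype :=
  to_subspace SS.1 (SS.2 _ _ (in_subspace x) (in_subspace y)).

Fact sub_bracket_linearl a x y z :
  sub_bracket (a *: x + y) z = a *: sub_bracket x z + sub_bracket y z.
Proof. by apply: val_inj; rewrite /= bracket_linearl. Qed.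

Fact sub_bracket_linearr a x y z :
  sub_bracket x (a *: y + z) = a *: sub_bracket x y + sub_bracket x z.
Proof. by apply: val_inj; rewrite /= bracket_linearr. Qed.

Fact sub_bracketxx x : sub_bracket x x = 0.
Proof. by apply: val_inj; rewrite /= bracketxx. Qed.

Fact sub_jacobi x y z : sub_bracket x (sub_bracket y z) +
  sub_bracket y (sub_bracket z x) + sub_bracket z (sub_bracket x y) = 0.
Proof. by apply: val_inj; rewrite /= jacobi. Qed.

HB.instance Definition _ := Lmodule_isLieAlgebra.Build K lie_subtype
  sub_bracket_linearl sub_bracket_linearr sub_bracketxx sub_jacobi.

Lemma lie_derived_val (J : set lie_subtype) :
  (val : lie_subtype -> g) @` lie_derived J = lie_derived (val @` J).
Proof.
rewrite /lie_derived -linear_span_image; congr linear_span; apply/seteqP; split.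
  move=> _ [_ [x Jx [y Jy <-]] <-]; exists (val x); first by exists x.
  by exists (val y) => //; exists y.
move=> _ [_ [x Jx <-] [_ [y Jy <-] <-]].
by exists (bracket x y) => //; exists x => //; exists y.
Qed.

Lemma semisimple_subtype : semisimple S -> semisimple [set: lie_subtype].
Proof.
move=> ss J [Js _ Jbr] [m Jm].
have J0 : (val : lie_subtype -> g) @` J = [set 0].
  apply: ss.
    split; first exact: image_subspace.
      by move=> _ [x _ <-]; apply: in_subspace.
    move=> x _ Sx [y Jy <-].
    by exists (bracket (to_subspace SS.1 Sx : lie_subtype) y) => //; apply: Jbr.
  exists m; rewrite -[RHS](_ : (val : lie_subtype -> g) @` [set 0] = _).
    rewrite -Jm; elim: m {Jm} => //= m ->; by rewrite lie_derived_val.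
  by rewrite image_set1.
apply/seteqP; split=> [x Jx|_ ->]; last exact: subspace0.
by apply: val_inj; rewrite /= -[_ = _]/([set 0] (val x)) -J0; exists x.
Qed.

End SubLie.

(** * Coordinates on finite-dimensional subspaces *)

Section Coordinates.
Variables (K : fieldType) (V : lmodType K).

Lemma linear_inverse (U W : lmodType K) (f : {linear U -> W}) : injective f ->
  (forall w, exists u, f u = w) ->
  exists f' : {linear W -> U}, cancel f f' /\ cancel f' f.
Proof.
move=> finj /choice[f' fK].
have f'_lin : linear f' by move=> a u v; apply: finj; rewrite linearP !fK.
exists (linear_of f'_lin).
by split=> // u; apply: finj; rewrite /= fK.
Qed.

(** The spanning list may be dependent; restricting its linear combinations to a complement of the
    relations makes them injective and keeps the range. *)
Lemma finite_dim_coordinates (S : set V) : finite_dim S ->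
  exists n (f : {linear 'rV[K]_n -> V}), injective f /\ range f = S.
Proof.
move=> [s ->]; pose m := size s.
pose F (v : 'rV[K]_m) := \sum_i v 0 i *: s`_i.
have F_lin : linear F.
  move=> a u v; rewrite /F scaler_sumr -big_split; apply: eq_bigr => i _.
  by rewrite !mxE scalerDl scalerA.
pose FL : {linear 'rV[K]_m -> V} := linear_of F_lin.
have Frange : range FL = linear_span [set` s].
  apply/seteqP; split.
    move=> _ [v _ <-]; apply: (subspace_sum (linear_span_subspace _)) => i _.
    apply: (subspaceZ (linear_span_subspace _)).
    by apply: (@sub_linear_span _ _ [set` s]); rewrite /= mem_nth.
  apply: linear_span_sub; first by apply: image_subspace.
  move=> x /= xs; have ix : (index x s < m)%N by rewrite index_mem.
  exists (delta_mx 0 (Ordinal ix)) => //;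
    rewrite -[LHS]/(F _) /F (bigD1 (Ordinal ix))//=.
  rewrite mxE !eqxx scale1r nth_index// big1 ?addr0// => i /negPf ni.
  by rewrite mxE ni andbF scale0r.
have [N NP] := vspace_of_subspace (preimage_subspace FL (zero_subspace V)).
pose U := (N^C)%VS; pose b := vbasis U.
pose G (v : 'rV[K]_(\dim U)) : 'rV[K]_m := \sum_i v 0 i *: b`_i.
have G_lin : linear G.
  move=> a u v; rewrite /G scaler_sumr -big_split; apply: eq_bigr => i _.
  by rewrite !mxE scalerDl scalerA.
pose GL : {linear 'rV[K]_(\dim U) -> 'rV[K]_m} :=
  linear_of G_lin.
have GU v : G v \in U.
  by apply: memv_suml => i _; rewrite memvZ// vbasis_mem// mem_nth// size_tuple.
exists (\dim U), (FL \o GL); split=> [|].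
  apply: raddf_inj => v /= v0.
  have : G v \in (N :&: U)%VS by rewrite memv_cap GU andbT; apply/NP.
  rewrite capv_compl memv0 => /eqP Gv0; apply/rowP => i; rewrite mxE.
  by move/freeP: (basis_free (vbasisP U)) => /(_ (v 0)); apply.
rewrite -Frange; apply/seteqP; split=> [_ [v _ <-]|_ [v _ <-]];
  first by exists (G v).
have : v \in (N + U)%VS by rewrite addv_complf memvf.
move=> /memv_addP[u /NP/= u0 [w wU ->]].
exists (\row_i coord b i w) => //=; rewrite [RHS](raddfD FL) /= u0 add0r.
congr (linear_of _ _); rewrite -[LHS]/(G _) /G [RHS](coord_vbasis wU);
  apply: eq_bigr => i _.
by rewrite mxE.
Qed.

Lemma finite_dim_range n (f : {linear 'rV[K]_n -> V}) : finite_dim (range f).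
Proof.
exists [seq f (delta_mx 0 i) | i <- enum 'I_n]; apply/seteqP; split.
  move=> _ [v _ <-]; rewrite [v]row_sum_delta linear_sum.
  apply: (subspace_sum (linear_span_subspace _)) => i _.
  rewrite linearZ; apply: (subspaceZ (linear_span_subspace _)).
  by apply: (@sub_linear_span _ _ [set` _]); apply/mapP; exists i;
    rewrite ?mem_enum.
apply: linear_span_sub; first exact: image_subspace.
by move=> _ /= /mapP[i _ ->]; exists (delta_mx 0 i).
Qed.

Lemma rowspace_of_subspace n (S : set 'rV[K]_n) : linear_subspace S ->
  exists W : 'M[K]_n, forall v, S v <-> (v <= W)%MS.
Proof.
move=> /vspace_of_subspace[U UP].
exists <<\matrix_(i < \dim U) (vbasis U)`_i>>%MS => v; rewrite genmxE; split.
  move=> /UP vU; rewrite (coord_vbasis vU); apply: summx_sub => i _.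
  by rewrite scalemx_sub// -[_`_i](rowK (fun i : 'I__ =>
    (vbasis U)`_i)) row_sub.
move=> /submxP[c ->]; apply/UP; rewrite mulmx_sum_row; apply: memv_suml => i _.
by rewrite memvZ// rowK vbasis_mem// mem_nth// size_tuple.
Qed.

Lemma finite_dim_sub (S T : set V) : linear_subspace T -> finite_dim S ->
  T `<=` S ->
  finite_dim T.
Proof.
move=> Ts /finite_dim_coordinates[n [f [finj fS]]] TS.
have [W WP] := rowspace_of_subspace (preimage_subspace f Ts).
suff -> : T = range (f \o mulmxr W : {linear _ ->
  _}) by apply: finite_dim_range.
apply/seteqP; split=> [x Tx|_ [v _ <-]]; last by apply/WP; rewrite submxMl.
have [v _ vx] : range f x by rewrite fS; apply: TS.
have /submxP[c vE] : (v <= W)%MS by apply/WP; rewrite /= vx.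
by exists c => //=; rewrite -vE.
Qed.

End Coordinates.

(** * Integrable modules are locally finite *)

Section LieModules.
Variables (K : fieldType) (g : lieAlgType K) (M : lieModType g).
Implicit Types (x y : g) (m : M).

HB.instance Definition _ x :=
  GRing.isLinear.Build K M M *:%R (lie_act x) (fun a m n =>
    act_linearr a x m n).

Definition lie_act_of m x := lie_act x m.
HB.instance Definition _ m :=
  GRing.isLinear.Build K g M *:%R (lie_act_of m) (fun a x y =>
    act_linearl a x y m).

Lemma lie_actZr x a m : lie_act x (a *: m) = a *: lie_act x m.
Proof. by rewrite linearZ. Qed.

Lemma lie_actZl a x m : lie_act (a *: x) m = a *: lie_act x m.
Proof. exact: (linearZ_LR (lie_act_of m)). Qed.

Lemma lie_act_swap x y m : lie_act x (lie_act y m) = lie_act y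
  (lie_act x m) + lie_act (bracket x y) m.
Proof. by rewrite act_bracket addrC subrK. Qed.

Lemma lie_act_span (X : set g) (Y Z : set M) x m : linear_subspace Z ->
  (forall y n, X y -> Y n -> Z (lie_act y n)) ->
  linear_span X x -> linear_span Y m -> Z (lie_act x m).
Proof.
move=> Zs XYZ Xx.
suff H : linear_span Y `<=` lie_act x @^-1` Z by exact: H.
apply: linear_span_sub => [|n Yn]; first exact: preimage_subspace.
suff H : linear_span X `<=` lie_act_of n @^-1` Z by exact: H.
apply: linear_span_sub => [|y Xy]; first exact: preimage_subspace.
exact: XYZ.
Qed.

Lemma lie_act_span1 (Y Z : set M) x m : linear_subspace Z ->
  (forall n, Y n -> Z (lie_act x n)) -> linear_span Y m -> Z (lie_act x m).
Proof.
move=> Zs YZ; apply: (@lie_act_span [set x]) => [//|y n ->|]; first exact: YZ.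
exact: sub_linear_span.
Qed.

Lemma orbit_finite_dim (F : set M) x : Int_g M -> finite_dim F ->
  exists T : set M, [/\ linear_subspace T, finite_dim T, F `<=` T &
    forall m, T m -> T (lie_act x m)].
Proof.
move=> Mint [t ->].
have /choice[b bE] : forall m, exists b : seq M,
    linear_span (range (fun n => iter n (lie_act x) m)) = linear_span [set` b].
  by move=> m; exact: Mint.
exists (linear_span [set` flatten [seq b m | m <- t]]).
have iterT m n : m \in t -> linear_span [set` flatten [seq b m | m <- t]]
  (iter n (lie_act x) m).
  move=> mt; have : linear_span [set` b m] (iter n (lie_act x) m).
    by rewrite -bE; apply: (@sub_linear_span _ _ (range _)); exists n.
  apply: linear_span_mono => u /= um; apply/flattenP; exists (b m) => //.
  exact: map_f.
split; [exact: linear_span_subspace|by exists (flatten [seq b m | m <- t])| |].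
  apply: linear_span_sub => [|m mt]; first exact: linear_span_subspace.
  exact: (iterT m 0%N).
move=> m; apply: lie_act_span1 => [|n /=]; first exact: linear_span_subspace.
move=> /flattenP[_ /mapP[u ut ->] nb].
have : linear_span (range (fun n => iter n (lie_act x) u)) n.
  by rewrite bE; exact: sub_linear_span.
apply: lie_act_span1 => [|_ [k _ <-]]; first exact: linear_span_subspace.
exact: (iterT u k.+1).
Qed.

Section Straightening.
Variables (S : set g) (F : set M).
Hypotheses (Ssub : lie_subalgebra S) (Fs : linear_subspace F).

(** This is [U_k(S) F], for the degree filtration of the enveloping algebra of [S]. *)
Fixpoint filtr (k : nat) : set M :=
  if k is k'.+1 then
    linear_span (filtr k' `|` [set z | exists x m, [/\ S x,
      filtr k' m & z = lie_act x m]])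
  else F.

Fixpoint words (l : seq g) (k : nat) : set M :=
  if k is k'.+1 then
    linear_span [set z | exists x m, [/\ x \in l,
      words l k' m & z = lie_act x m]]
  else F.

(* Sums of [x ^ a] applied to words in the letters [l], of total length [k],
   up to shorter words in the letters [S]. *)
Fixpoint pulled (x : g) (l : seq g) (k : nat) : set M :=
  if k is k'.+1 then
    linear_span ([set lie_act x m | m in pulled x l k'] `|` words l k `|` filtr
      k')
  else F.

Lemma filtr_subspace k : linear_subspace (filtr k).
Proof. by case: k => //= k; apply: linear_span_subspace. Qed.

Lemma filtrS k : filtr k `<=` filtr k.+1.
Proof. by move=> m Fm; exact: (sub_linear_span (or_introl Fm)). Qed.

Lemma filtr_act k x m : S x -> filtr k m -> filtr k.+1 (lie_act x m).
Proof.
move=> Sx Fm; apply: (@sub_linear_span _ _ (_ `|` _)); right.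
by exists x, m.
Qed.

Lemma pulled_subspace x l k : linear_subspace (pulled x l k).
Proof. by case: k => //= k; apply: linear_span_subspace. Qed.

Lemma words_act l k x m : x \in l -> words l k m -> words l k.+1 (lie_act x m).
Proof.
move=> xl Wm.
by apply: (@sub_linear_span _ _ [set z | exists x m, [/\ x \in l,
  words l k m & z = lie_act x m]]); exists x, m.
Qed.

Lemma words_filtr l k : (forall x, x \in l -> S x) -> words l k `<=` filtr k.
Proof.
move=> lS; elim: k => //= k IHk; apply: linear_span_mono =>
  _ [x [m [xl Wm ->]]].
by right; exists x, m; split; [apply: lS|apply: IHk|].
Qed.

Lemma pulled_filtr x l k : S x -> (forall y, y \in l -> S y) ->
  pulled x l k `<=` filtr k.
Proof.
move=> Sx lS; elim: k => //= k IHk; apply: linear_span_sub => [|z].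
  exact: (filtr_subspace k.+1).
move=> [[[m Pm <-]|]|]; last exact: filtrS.
  by apply: filtr_act => //; apply: IHk.
exact: (@words_filtr l k.+1).
Qed.

(** Pulling [x] to the left of [y] leaves the bracket of [y] and [x], a single letter of [S], so the
    error is a shorter word. *)
Lemma pulled_act x l k y m : S x -> (forall y, y \in l -> S y) ->
  y \in x :: l -> pulled x l k m -> pulled x l k.+1 (lie_act y m).
Proof.
move=> Sx lS; rewrite inE => /predU1P[-> Pm|yl].
  by apply: (@sub_linear_span _ _ (_ `|` _ `|` _)); left; left; exists m.
elim: k m => [m Fm|k IHk m].
  apply: (@sub_linear_span _ _ (_ `|` _ `|` _)); left; right.
  exact: words_act.
apply: lie_act_span1 => [|z]; first exact: (pulled_subspace x l k.+2).
move=> [[[n Pn <-]|Wz]|Fz].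
- rewrite lie_act_swap; apply: (subspaceD (pulled_subspace x l k.+2)).
    apply: (@sub_linear_span _ _ (_ `|` _ `|` _)); left; left.
    by exists (lie_act y n) => //; apply: IHk.
  apply: (@sub_linear_span _ _ (_ `|` _ `|` _)); right.
  apply: filtr_act; last exact: (@pulled_filtr x l).
  by apply: Ssub.2 => //; apply: lS.
- apply: (@sub_linear_span _ _ (_ `|` _ `|` _)); left; right.
  exact: words_act.
- apply: (@sub_linear_span _ _ (_ `|` _ `|` _)); right.
  by apply: filtr_act => //; apply: lS.
Qed.

Lemma words_pulled x l k : S x -> (forall y, y \in l -> S y) ->
  words (x :: l) k `<=` pulled x l k.
Proof.
move=> Sx lS; elim: k => [//|k IHk].
apply: linear_span_sub => [|_ [y [m [yl Wm ->]]]];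
  first exact: (pulled_subspace x l k.+1).
by apply: pulled_act => //; apply: IHk.
Qed.

Hypotheses (Mint : Int_g M) (Ffin : finite_dim F).

(** In an ordered word the letters act one after the other. Each new letter [x] enlarges the space
    reached so far to its [x]-orbits, which stay finite-dimensional by integrability. *)
Lemma ordered_finite_dim l : (forall x, x \in l -> S x) ->
  exists O : set M, [/\ linear_subspace O, finite_dim O, F `<=` O &
    forall k, words l k.+1 `<=` linear_span (O `|` filtr k)].
Proof.
elim: l => [|x l IHl] lS.
  exists F; split=> // k; apply: linear_span_sub;
    first exact: linear_span_subspace.
  by move=> z [x [m [xl _ _]]]; rewrite in_nil in xl.
have Sx : S x by apply: lS; rewrite mem_head.
have lS' y : y \in l -> S y by move=> yl; apply: lS; rewrite inE yl orbT.
have [O [Os Ofin FO OW]] := IHl lS'.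
have [T [Ts Tfin OT Tx]] := orbit_finite_dim x Mint Ofin.
exists T; split=> //; first exact: subset_trans OT.
move=> k; apply: subset_trans (@words_pulled x l k.+1 Sx lS') _.
have span_s j := linear_span_subspace (T `|` filtr j).
elim: k => [|k IHk]; apply: linear_span_sub => // z [[[m Pm <-]|Wz]|Fz].
- by apply: (@sub_linear_span _ _ (_ `|` _)); left; apply/Tx/OT/FO.
- by have := OW _ _ Wz; apply: linear_span_mono; apply: setSU.
- by apply: (@sub_linear_span _ _ (_ `|` _)); right.
- have := IHk _ Pm; apply: lie_act_span1 => // n [Tn|Fn].
    by apply: (@sub_linear_span _ _ (_ `|` _)); left; apply: Tx.
  by apply: (@sub_linear_span _ _ (_ `|` _)); right; apply: filtr_act.
- by have := OW _ _ Wz; apply: linear_span_mono; apply: setSU.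
- by apply: (@sub_linear_span _ _ (_ `|` _)); right.
Qed.

Lemma filtr_words l k : S = linear_span [set` l] ->
  filtr k.+1 `<=` linear_span (words l k.+1 `|` filtr k).
Proof.
move=> SE; have span_s j := linear_span_subspace (words l j.+1 `|` filtr j).
elim: k => [|k IHk]; apply: linear_span_sub => // z [Fz|[x [m [Sx Fm ->]]]].
- by apply: (@sub_linear_span _ _ (_ `|` _)); right.
- move: Sx; rewrite SE => /lie_act_span; apply; last exact: sub_linear_span Fm.
    exact: span_s.
  move=> y n yl Fn; apply: (@sub_linear_span _ _ (_ `|` _)); left.
  exact: words_act.
- by apply: (@sub_linear_span _ _ (_ `|` _)); right.
- move: Sx; rewrite SE => /lie_act_span; apply; last exact: IHk.
    exact: span_s.
  move=> y n yl [Wn|Fn]; apply: (@sub_linear_span _ _ (_ `|` _)).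
    by left; apply: words_act.
  by right; apply: filtr_act => //; rewrite SE; apply: sub_linear_span.
Qed.

End Straightening.

Theorem locally_finite (S : set g) (F : set M) : lie_subalgebra S ->
  finite_dim S ->
  Int_g M -> linear_subspace F -> finite_dim F ->
  exists E : set M, [/\ linear_subspace E, finite_dim E, F `<=` E &
    forall x m, S x -> E m -> E (lie_act x m)].
Proof.
move=> Ssub [l SE] Mint Fs Ffin.
have lS x : x \in l -> S x by move=> xl; rewrite SE; apply: sub_linear_span.
have [O [Os Ofin FO OW]] := ordered_finite_dim Ssub Fs Mint Ffin lS.
have filtrO k : filtr S F k `<=` O.
  elim: k => [//|k IHk]; apply: (subset_trans (filtr_words SE)).
  apply: linear_span_sub => // m [Wm|/IHk//].
  suff H : linear_span (O `|` filtr S F k) `<=` O by exact: H (OW _ _ Wm).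
  by apply: linear_span_sub => // n [//|/IHk].
have filtr_le i j : (i <= j)%N -> filtr S F i `<=` filtr S F j.
  move=> /subnK <-; elim: (j - i)%N => // k IHk; rewrite addSn.
  exact: subset_trans IHk (@filtrS S F _).
(* [O] bounds the dimension but need not be [S]-stable; the union of the filtration is stable and
   lies in [O]. *)
exists [set m | exists k, filtr S F k m].
have Es : linear_subspace [set m | exists k, filtr S F k m].
  split; first by exists 0%N; apply: subspace0 Fs.
  move=> a u v [i ui] [j vj]; exists (maxn i j);
    apply: (filtr_subspace S Fs _).2.
    by apply: filtr_le ui; rewrite leq_maxl.
  by apply: filtr_le vj; rewrite leq_maxr.
split=> // [|m Fm|x m Sx [k Fm]]; last by exists k.+1; apply: filtr_act.
  by apply: finite_dim_sub Ofin _ => // m [k /filtrO].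
by exists 0%N.
Qed.

End LieModules.

(** * Weyl's theorem on finite-dimensional pieces of a module *)

Section WeylLocal.
Variables (C : numClosedFieldType) (g : lieAlgType C) (M : lieModType g).

(** [p] is a bare function: it goes through coordinates that are meaningful on [E] and arbitrary
    elsewhere. *)
Theorem weyl_local (S : set g) (E Y : set M) :
  lie_subalgebra S -> finite_dim S -> semisimple S ->
  finite_dim E -> (forall x m, S x -> E m -> E (lie_act x m)) ->
  linear_subspace Y -> Y `<=` E -> (forall x m, S x -> Y m ->
    Y (lie_act x m)) ->
  exists p : M -> M, [/\ forall a u v, E u -> E v ->
    p (a *: u + v) = a *: p u + p v,
    forall u, E u -> Y (p u), forall u, Y u -> p u = u &
    forall x u, S x -> E u -> p (lie_act x u) = lie_act x (p u)].
Proof.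
move=> Ssub /finite_dim_coordinates[d [f [finj fS]]] Sss.
move=> /finite_dim_coordinates[n [psi [psi_inj psiE]]] Est Ys YE Yst.
pose L := lie_subtype Ssub.
have fSv v : S (f v) by rewrite -fS; exists v.
pose phi0 v : L := to_subspace Ssub.1 (fSv v).
have phi_lin : linear phi0.
  by move=> a u v; apply: val_inj; rewrite /= linearP.
pose phi : {linear 'rV[C]_d -> L} := linear_of phi_lin.
have [coo [phiK cooK]] : exists coo : {linear L ->
  'rV[C]_d}, cancel phi coo /\ cancel coo phi.
  apply: linear_inverse => [u v /(congr1 val)/= /finj//|x].
  have [v _ vx] : range f (val x) by rewrite fS; exact: in_subspace.
  by exists v; apply: val_inj.
have psiEv v : E (psi v) by rewrite -psiE; exists v.
have coordE u : exists v, E u -> psi v = u.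
  by have [|nE] := pselect (E u); [rewrite -{1}psiE => -[v _ <-];
    exists v|exists 0].
have /choice[c cE] := coordE.
have cP v : c (psi v) = v by apply/psi_inj/cE.
(* The sign turns the left action into a right one. *)
have matE (x : L) : exists A : 'M[C]_n, forall v,
  psi (v *m A) = - lie_act (val x) (psi v).
  exists (\matrix_i (- c (lie_act (val x) (psi (delta_mx 0 i))))) => v.
  rewrite mulmx_sum_row linear_sum {2}[v]row_sum_delta linear_sum linear_sum
    -sumrN.
  apply: eq_bigr => i _; rewrite rowK !linearZ/= linearN cE ?scalerN//.
  by apply: Est; [exact: in_subspace|].
have /choice[rho0 rhoE] := matE.
have mat_inj (A B : 'M[C]_n) : (forall v, psi (v *m A) = psi (v *m B)) -> A = B.
  by move=> AB; apply/row_matrixP => i; rewrite !rowE; apply/psi_inj/AB.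
have rho_lin : linear rho0.
  move=> a x y; apply: mat_inj => v.
  rewrite mulmxDr -scalemxAr linearP !rhoE/= scalerN -opprD.
  by congr (- _); rewrite act_linearl.
pose rho : {linear L -> 'M[C]_n} := linear_of rho_lin.
have rhoE' x v : psi (v *m rho x) = - lie_act (val x) (psi v) := rhoE x v.
have psiB u v : psi (u - v) = psi u - psi v by rewrite linearB.
have actN x m : lie_act x (- m) = - lie_act x m by rewrite linearN.
have rho_br : representation rho.
  move=> x y; apply: mat_inj => v; rewrite /mxbr mulmxBr !mulmxA psiB !rhoE'.
  by rewrite !actN !opprK act_bracket opprB.
have [W WP] := rowspace_of_subspace (preimage_subspace psi Ys).
have Wst x : stablemx W (rho x).
  apply/row_subP => i; rewrite row_mul; apply/WP; rewrite /= rhoE.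
  apply: (subspaceN Ys); apply: Yst; first exact: in_subspace.
  by apply/WP; rewrite row_sub.
have [p [pW Wp pC]] := weyl_matrix phiK cooK
  (semisimple_subtype Sss) rho_br Wst.
exists (fun u => psi (c u *m p)); split=> [a u v|u Eu|u Yu|x u Sx Eu].
- move=> /cE {1 2}<- /cE {1 2}<-; rewrite -linearP cP !cP.
  by rewrite mulmxDl -scalemxAl linearP.
- by apply/WP; rewrite (submx_trans (submxMl _ _)).
- have uE := cE u (YE _ Yu).
  have /submxP[D DE] : (c u <= W)%MS by apply/WP; rewrite /= uE.
  by rewrite DE -mulmxA Wp -DE.
- pose x' : L := to_subspace Ssub.1 Sx.
  have -> : c (lie_act x u) = - (c u *m rho x').
    apply: psi_inj; rewrite [RHS]linearN/= rhoE' opprK !cE//; exact: Est.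
  by rewrite mulNmx -mulmxA -pC mulmxA [LHS]linearN/= rhoE' opprK.
Qed.

End WeylLocal.

(** * Weight modules *)

Section DirectSums.
Variables (K : fieldType) (V : lmodType K) (I : Type) (F : I -> set V).
Hypothesis Fs : forall i, linear_subspace (F i).
(** Finite supports are duplicate-free lists, which require a decidable equality on the arbitrary
    index type. *)
Let J := {classic I}.

Lemma sum_undup_cat (s t : seq J) (w : J -> V) : uniq s ->
  \sum_(i <- undup (s ++ t) | i \in s) w i = \sum_(i <- s) w i.
Proof.
move=> us; rewrite -big_filter; apply: perm_big; apply: uniq_perm => //.
  by rewrite filter_uniq ?undup_uniq.
by move=> i; rewrite mem_filter mem_undup mem_cat; case: (i \in s).
Qed.

Lemma span_bigcup_decomposition (D : set I) v : linear_span
  (\bigcup_(i in D) F i) v ->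
  exists s : seq J, exists w : J -> V,
  [/\ uniq s, forall i, i \in s -> D i, forall i,
    F i (w i) & v = \sum_(i <- s) w i].
Proof.
set A := [set v | exists s : seq J, exists w : J -> V,
  [/\ uniq s, forall i, i \in s -> D i, forall i,
    F i (w i) & v = \sum_(i <- s) w i]].
suff H : linear_span (\bigcup_(i in D) F i) `<=` A by exact: H.
apply: linear_span_sub => [|u [i Di Fu]].
  split.
    exists [::], (fun=> 0); rewrite big_nil; split=> // i; exact: subspace0.
  move=> a u1 u2 [s1 [w1 [us1 D1 F1 ->]]] [s2 [w2 [us2 D2 F2 ->]]].
  exists (undup (s1 ++ s2)), (fun i => a *: (if i \in s1 then w1 i else 0) +
    (if i \in s2 then w2 i else 0)); split; first exact: undup_uniq.
  - by move=> i; rewrite mem_undup mem_cat => /orP[/D1|/D2].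
  - by move=> i; apply: (Fs i).2; case: ifP => // _; apply: subspace0.
  - rewrite big_split/= -scaler_sumr -!big_mkcond/= sum_undup_cat//;
    congr (_ + _).
    rewrite -(sum_undup_cat s1 w2 us2); apply: perm_big; apply: uniq_perm;
      rewrite ?undup_uniq// => i.
    by rewrite !mem_undup !mem_cat orbC.
exists [:: (i : J)], (fun j : J => if j == (i : J) then u else 0); split=> //.
- by move=> j; rewrite inE => /eqP ->.
- by move=> j; case: eqP => [->|_] //; apply: subspace0.
- by rewrite big_seq1 eqxx.
Qed.

Hypothesis Fdirect : direct_sum F.

Lemma direct_sum_independent (s : seq J) (w : J -> V) : uniq s ->
  (forall i, i \in s -> F i (w i)) -> \sum_(i <- s) w i = 0 ->
  forall i, i \in s -> w i = 0.
Proof.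
move=> us Fw s0 i is_.
have ix : (index i s < size s)%N by rewrite index_mem.
have := Fdirect.2 (size s) (fun k => nth i s k) (fun k => w (nth i s k)).
move=> /(_ _ _ _ (Ordinal ix)); rewrite /= nth_index//; apply.
- move=> j k jk; apply/val_inj/eqP.
  by rewrite -(nth_uniq (i : J) (ltn_ord j) (ltn_ord k) us); apply/eqP.
- by move=> k; apply: Fw; rewrite mem_nth.
- by rewrite -[RHS]s0 (big_nth i) big_mkord.
Qed.

Lemma direct_sum_disjoint i c :
  F i c -> linear_span (\bigcup_(j in [set j | j <> i]) F j) c -> c = 0.
Proof.
move=> Fc /span_bigcup_decomposition[s [w [us sD Fw cE]]].
have is_ : (i : J) \notin s by apply/negP => /sD.
have := @direct_sum_independent ((i : J) :: s) (fun j : J =>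
  if j == (i : J) then - c else w j).
rewrite /= is_ us => /(_ isT _ _ i (mem_head _ _)); rewrite eqxx => H.
apply/eqP; rewrite -oppr_eq0; apply/eqP/H => [j|].
  by case: eqP => [->|_ _] //; move=> _; apply: subspaceN.
rewrite big_cons eqxx {1}cE addrC; apply/eqP; rewrite subr_eq0; apply/eqP.
rewrite big_seq [RHS]big_seq; apply: eq_bigr => j js.
by case: eqP => // ji; rewrite -ji js in is_.
Qed.

Lemma direct_sum_projections : exists p : I -> {linear V -> V},
  [/\ forall i v, F i (p i v), forall i v, F i v -> p i v = v,
      forall i j v, i <> j -> F i v -> p j v = 0
    & forall v, (forall i, p i v = 0) -> v = 0].
Proof.
(* [c] is the component of [v] at [i] when [v - c] lies in the sum of the other summands. Uniqueness
   of [c] yields linearity. *)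
pose R i v c := F i c /\ linear_span (\bigcup_(j in [set j | j <> i]) F j)
  (v - c).
have sp i := linear_span_subspace (\bigcup_(j in [set j | j <> i]) F j).
have Runiq i v c1 c2 : R i v c1 -> R i v c2 -> c1 = c2.
  move=> [F1 R1] [F2 R2]; apply/eqP; rewrite -subr_eq0; apply/eqP.
  apply: (@direct_sum_disjoint i); first exact: (subspaceB (Fs i)).
  have -> : c1 - c2 = (v - c2) - (v - c1) by rewrite opprB [RHS]addrC addrA
    subrK.
  exact: (subspaceB (sp i)).
have Rex i v : exists c, R i v c.
  have : linear_span (\bigcup_(j in setT) F j) v by rewrite Fdirect.1.
  move=> /span_bigcup_decomposition[s [w [us _ Fw ->]]].
  have rest : linear_span (\bigcup_(j in [set j | j <> i]) F j)
      (\sum_(j <- s | j != (i : J)) w j).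
    apply: (subspace_sum (sp i)) => j /eqP ji.
    by apply: (@sub_linear_span _ _ (\bigcup_(j in _) F j)); exists j.
  exists (\sum_(j <- s | j == (i : J)) w j); split.
    by apply: (subspace_sum (Fs i)) => j /eqP ->.
  by rewrite [X in X - _](bigID (fun j : J =>
    j == (i : J)))/= addrAC subrr add0r.
have /choice[p0 p0R] : forall i, exists p : V -> V, forall v, R i v (p v).
  by move=> i; have /choice[f fR] := Rex i; exists f.
have p_lin i : linear (p0 i).
  move=> a u v; apply: Runiq (p0R i _) _.
  have [[F1 R1] [F2 R2]] := (p0R i u, p0R i v); split; first exact: (Fs i).2.
  have -> : a *: u + v - (a *: p0 i u + p0 i v) = a *: (u - p0 i u) +
    (v - p0 i v).
    by rewrite scalerBr opprD addrACA.
  exact: (sp i).2.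
exists (fun i => linear_of (p_lin i)).
have pid i v : F i v -> p0 i v = v.
  move=> Fv; apply: Runiq (p0R i v) _; split=> //; rewrite subrr;
    exact: subspace0 (sp i).
have p0_ i j v : i <> j -> F i v -> p0 j v = 0.
  move=> ij Fv; apply: Runiq (p0R j v) _; split; first exact: subspace0.
  rewrite subr0; apply: (@sub_linear_span _ _ (\bigcup_(j in _) F j)).
  by exists i.
split=> //= [i v|v v0]; first by case: (p0R i v).
have : linear_span (\bigcup_(j in setT) F j) v by rewrite Fdirect.1.
move=> /span_bigcup_decomposition[s [w [us _ Fw vE]]].
rewrite vE big_seq big1// => i si.
rewrite -(v0 i) vE [linear_of _ _](raddf_sum (linear_of (p_lin i)))/=.
rewrite (bigD1_seq i)//= big1 ?addr0 => [|j /eqP ji]; last exact: p0_ (Fw j).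
exact/esym/pid.
Qed.

End DirectSums.

Section Weights.
Variables (K : fieldType) (g : lieAlgType K) (P : {pred g}) (h : subLmodType P).
Implicit Types (l mu nu : {scalar h}) (x y : g).

Lemma scalar_ext l mu : l =1 mu -> l = mu.
Proof.
case: l mu => [f c] [f' c'] ff'; have E : f = f' by apply/funext => t;
  apply: ff'.
case: f' / E c' {ff'} => -[[a'] [b']]; case: c => [[a] [b]].
by rewrite (Prop_irrelevance a a') (Prop_irrelevance b b').
Qed.

End Weights.

Section WeightModules.
Variables (K : fieldType) (g : lieAlgType K) (P : {pred g}) (h : subLmodType P).
Variable M : lieModType g.
Implicit Types (l mu nu : {scalar h}) (x y : g) (m : M) (N T Z : set M).

(** The zero form is allowed, which covers the elements of the abelian [h] itself. *)
Definition homogeneous x := exists alpha : {scalar h}, root_space alpha x.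

Definition word_act (w : seq g) m := foldr (fun x n => lie_act x n) m w.

Definition submodule N :=
  linear_subspace N /\ forall x m, N m -> N (lie_act x m).

(** Only words in letters of [Q] are used, so that homogeneous letters give each word a definite
    weight. Taking [Q] inside some [G i] makes the words commute with a [G i]-equivariant map. *)
Definition generated (Q : set g) Z := linear_span
  [set m | exists w z, [/\ forall x, x \in w -> Q x, Z z & m = word_act w z]].

Lemma word_act_is_linear w : linear (word_act w).
Proof.
move=> a u v; elim: w => //= x w ->.
exact: act_linearr.
Qed.
HB.instance Definition _ w :=
  GRing.isLinear.Build K M M *:%R (word_act w) (word_act_is_linear w).

Lemma word_act_sub (S : set g) Z w m : (forall x m, S x -> Z m ->
  Z (lie_act x m)) ->
  (forall x, x \in w -> S x) -> Z m -> Z (word_act w m).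
Proof.
move=> SZ; elim: w => //= x w IHw wS Zm; apply: SZ; first by apply: wS;
  rewrite mem_head.
by apply: IHw => // y yw; apply: wS; rewrite inE yw orbT.
Qed.

Lemma submoduleI N T : submodule N -> submodule T -> submodule (N `&` T).
Proof.
move=> [Ns Nact] [Ts Tact]; split; last by move=> x m [Nm Tm]; split;
  [apply: Nact|apply: Tact].
split; first by split; apply: subspace0.
by move=> a u v [Nu Tu] [Nv Tv]; split; [apply: Ns.2|apply: Ts.2].
Qed.

Lemma generated_subspace Q Z : linear_subspace (generated Q Z).
Proof. exact: linear_span_subspace. Qed.

Lemma mem_generated Q Z w z : (forall x, x \in w -> Q x) -> Z z ->
  generated Q Z (word_act w z).
Proof. by move=> wQ Zz; apply: (@sub_linear_span _ _ [set m | exists w z, _]);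
  exists w, z. Qed.

Lemma sub_generated Q Z : Z `<=` generated Q Z.
Proof. by move=> z Zz; apply: (@mem_generated _ _ [::]). Qed.

Lemma generated_sub Q Z N : submodule N -> Z `<=` N -> generated Q Z `<=` N.
Proof.
move=> [Ns Nact] ZN; apply: linear_span_sub => // _ [w [z [_ /ZN Nz ->]]].
by apply: (@word_act_sub setT) => // x m _; apply: Nact.
Qed.

Lemma weight_space_subspace l : linear_subspace (@weight_space K g P h M l).
Proof.
split=> [t|a u v ul vl t]; first by rewrite linear0 scaler0.
by rewrite linearP/= ul vl scalerDr !scalerA mulrC.
Qed.

Lemma weight_shift alpha x l mu m : root_space alpha x ->
  (forall t : h, mu t = l t + alpha t) ->
  weight_space l m -> weight_space mu (lie_act x m).
Proof.
move=> xa muE ml t.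
by rewrite lie_act_swap ml lie_actZr xa lie_actZl -scalerDl muE.
Qed.

Hypothesis g_span : linear_span homogeneous = setT.

Lemma generated_submodule Z : submodule (generated homogeneous Z).
Proof.
split=> [|x m]; first exact: generated_subspace.
have : linear_span homogeneous x by rewrite g_span.
apply: lie_act_span => [|y _ hy [w [z [wh Zz ->]]]];
  first exact: generated_subspace.
rewrite -[lie_act y _]/(word_act (y :: w) z); apply: mem_generated => // y'.
by rewrite inE => /predU1P[->|/wh].
Qed.

Hypothesis M_direct : direct_sum (@weight_space K g P h M).
Variable p : {scalar h} -> {linear M -> M}.
Hypothesis p_weight : forall l m, weight_space l (p l m).
Hypothesis p_id : forall l m, weight_space l m -> p l m = m.
Hypothesis p_other : forall l mu m, l <> mu -> weight_space l m -> p mu m = 0.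
Hypothesis p_eq0 : forall m, (forall l, p l m = 0) -> m = 0.

Lemma weight_induction T : linear_subspace T ->
  (forall l, weight_space l `<=` T) -> forall m, T m.
Proof.
move=> Ts lT m; have : linear_span (\bigcup_l
  (@weight_space K g P h M l)) m by rewrite M_direct.1.
suff H : linear_span (\bigcup_l (@weight_space K g P h M l)) `<=` T by exact: H.
by apply: linear_span_sub => // n [l _] /lT.
Qed.

Lemma act_proj alpha x l mu m : root_space alpha x ->
  (forall t : h, mu t = l t + alpha t) ->
    p mu (lie_act x m) = lie_act x (p l m).
Proof.
move=> xa muE; pose T := [set m | p mu (lie_act x m) - lie_act x (p l m) = 0].
have Ts : linear_subspace T.
  split=> [|a u v Tu Tv]; first by rewrite /T/= !linear0 addr0.
  rewrite /T/= act_linearr linearP [p l _]linearP act_linearr/= opprD addrACA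
    -scalerBr.
  by rewrite Tu Tv scaler0 addr0.
suff : T m by move=> /eqP; rewrite subr_eq0 => /eqP.
apply: weight_induction => // nu {}m mnu; rewrite /T/=.
have [nul|nul] := pselect (nu = l).
  rewrite -nul p_id; first by rewrite p_id ?subrr.
  by apply: weight_shift mnu => // t; rewrite muE nul.
rewrite (p_other nul mnu) linear0 subr0.
apply: (@p_other (nu \+ alpha : {scalar h})) => [E|];
  last exact: weight_shift mnu.
apply: nul; apply: scalar_ext => t.
by apply: (addIr (alpha t)); rewrite -muE -E.
Qed.

(** [beta] is the sum of the roots of the letters. *)
Lemma word_proj w : (forall x, x \in w -> homogeneous x) ->
  exists beta : {scalar h}, forall l mu, (forall t : h, mu t = l t + beta t) ->
    forall m, p mu (word_act w m) = word_act w (p l m).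
Proof.
elim: w => [_|x w IHw wh].
  exists (\0 : {scalar h}) => l mu E m /=; congr (p _ _).
  by apply: scalar_ext => t; rewrite E addr0.
have [alpha xa] := wh x (mem_head _ _).
have [|beta IH] := IHw; first by move=> y yw; apply: wh; rewrite inE yw orbT.
exists (beta \+ alpha : {scalar h}) => l mu E m /=.
rewrite -(IH l (l \+ beta : {scalar h}))//.
by apply: act_proj xa _ => t; rewrite E/= addrA.
Qed.

Lemma word_proj0 w l : (forall x, x \in w -> homogeneous x) ->
  (forall m, p l (word_act w m) = word_act w (p l m)) \/
  (forall m, weight_space l m -> p l (word_act w m) = 0).
Proof.
move=> wh; have [beta bE] := word_proj wh.
have [b0|/existsNP[t0 bt0]] := pselect (forall t : h, beta t = 0).
  by left; apply: bE => t; rewrite b0 addr0.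
right=> m ml; rewrite (bE (l \- beta : {scalar h})) => [|t];
  last by rewrite /= subrK.
rewrite (@p_other l) ?linear0// => E; apply: bt0.
have /(congr1 (fun f : {scalar h} => f t0))/= := E.
by move=> /esym/eqP; rewrite subr_eq addrC -subr_eq subrr eq_sym => /eqP.
Qed.

(** Weight components separate: acting by [t] in [h] minus the scalar [j t] removes the component at
    [j] and multiplies the one at [i] by [i t - j t], nonzero for a suitable [t]. Induction on the
    number of components follows. *)
Lemma submodule_proj T l m : submodule T -> T m -> T (p l m).
Proof.
move=> [Ts Tact] Tm.
have : linear_span (\bigcup_(j in setT)
  (@weight_space K g P h M j)) m by rewrite M_direct.1.
move=> /(span_bigcup_decomposition weight_space_subspace)[s [w [us _ ww mE]]].
have Tw : forall i, i \in s -> T (w i).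
  move: Tm; rewrite mE; elim: s us w ww {mE} =>
    [//|j s IHs] /= /andP[js us] w ww.
  rewrite big_cons => Tsum.
  have Tws i : i \in s -> T (w i).
    move=> is_; have /existsNP[t ijt] : ~ (forall t : h,
      (i : {scalar h}) t = (j : {scalar h}) t).
      by move=> /scalar_ext ij; rewrite -ij is_ in js.
    have ijt0 : (i : {scalar h}) t - (j : {scalar h}) t != 0 by rewrite
      subr_eq0; apply/eqP.
    rewrite -[w i](scalerK ijt0); apply: subspaceZ => //.
    pose w' k := ((k : {scalar h}) t - (j : {scalar h}) t) *: w k.
    apply: (IHs us w') => //.
      by move=> k; apply: (subspaceZ (weight_space_subspace _)); exact: ww.
    have -> : \sum_(k <- s) w' k = lie_act (val t) (w j + \sum_(k <- s) w k) -
        (j : {scalar h}) t *: (w j + \sum_(k <- s) w k).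
      rewrite linearD/= scalerDr ww opprD addrACA subrr add0r linear_sum
        scaler_sumr -sumrB.
      by apply: eq_bigr => k _; rewrite /w' scalerBl /= ww.
    by apply: subspaceB => //; [apply: Tact|apply: subspaceZ].
  move=> i; rewrite inE => /predU1P[->|]; last exact: Tws.
  have -> : w j = (w j + \sum_(k <- s) w k) - \sum_(k <- s) w k by rewrite
    addrK.
  apply: subspaceB => //; rewrite big_seq; exact: subspace_sum.
rewrite mE linear_sum big_seq; apply: subspace_sum => // i is_ /=.
have [<-|il] := pselect ((i : {scalar h}) = l); first by rewrite p_id//;
  apply: Tw.
by rewrite (p_other il)//; apply: subspace0.
Qed.

End WeightModules.

(** * Simple submodules *)

Section SimpleSubmodules.
Variables (C : numClosedFieldType) (g : lieAlgType C) (P : {pred g})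
  (h : subLmodType P).
Variable M : lieModType g.
Implicit Types (l mu nu : {scalar h}) (x y : g) (m : M) (N T X Z : set M).
Variable G : nat -> set g.
Hypothesis G_semisimple : forall i, [/\ lie_subalgebra (G i),
  finite_dim (G i) & semisimple (G i)].
Hypothesis G_mono : forall i, G i `<=` G i.+1.
Hypothesis G_cover : \bigcup_i G i = setT.
Let homog := homogeneous h.
Hypothesis g_span : linear_span homog = setT.
Hypothesis M_int : Int_g M.
Hypothesis M_direct : direct_sum (@weight_space C g P h M).
Variable p : {scalar h} -> {linear M -> M}.
Hypothesis p_weight : forall l m, weight_space l (p l m).
Hypothesis p_id : forall l m, weight_space l m -> p l m = m.
Hypothesis p_other : forall l mu m, l <> mu -> weight_space l m -> p mu m = 0.
Hypothesis p_eq0 : forall m, (forall l, p l m = 0) -> m = 0.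

Lemma G_le i j : (i <= j)%N -> G i `<=` G j.
Proof.
move=> /subnK <-; elim: (j - i)%N => // k IHk; rewrite addSn.
exact: subset_trans IHk (@G_mono _).
Qed.

Lemma G_seq (s : seq g) : exists i, forall x, x \in s -> G i x.
Proof.
elim: s => [|x s [i Hi]]; first by exists 0%N.
have [j _ Gx] : (\bigcup_i G i) x by rewrite G_cover.
exists (maxn i j) => y; rewrite inE => /predU1P[->|/Hi].
  by apply: G_le Gx; rewrite leq_maxr.
by apply: G_le; rewrite leq_maxl.
Qed.

Lemma generated_exhaust Z m : generated homog Z m ->
  exists i, forall j, (i <= j)%N -> generated (homog `&` G j) Z m.
Proof.
suff H : generated homog Z `<=` [set m | exists i, forall j, (i <= j)%N ->
    generated (homog `&` G j) Z m] by exact: H.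
apply: linear_span_sub => [|_ [w [z [wh Zz ->]]]].
  split; first by exists 0%N => j _; apply: subspace0;
    exact: generated_subspace.
  move=> a u v [i Hu] [j Hv]; exists (maxn i j) => k;
    rewrite geq_max => /andP[ik jk].
  by apply: (generated_subspace _ _).2; [apply: Hu|apply: Hv].
have [i wG] := G_seq w; exists i => j ij.
by apply: mem_generated => // x xw; split;
  [exact: wh|apply: G_le ij _ (wG _ xw)].
Qed.

Lemma local_projection i Z X T : linear_subspace Z -> finite_dim Z ->
  Z `<=` X ->
  submodule X -> submodule T -> T `<=` X ->
  exists E : set M, exists q : M -> M,
  [/\ linear_subspace E /\ E `<=` X, Z `<=` E,
      forall x m, G i x -> E m -> E (lie_act x m) &
  [/\ forall a u v, E u -> E v -> q (a *: u + v) = a *: q u + q v,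
      forall u, E u -> T (q u), forall u, T u -> E u -> q u = u &
      forall x u, G i x -> E u -> q (lie_act x u) = lie_act x (q u)]].
Proof.
move=> Zs Zfin ZX [Xs Xact] [Ts Tact] TX.
have [Gsub Gfin Gss] := G_semisimple i.
have [E [Es Efin ZE Est]] := locally_finite Gsub Gfin M_int Zs Zfin.
have EXs : linear_subspace (E `&` X).
  split; first by split; apply: subspace0.
  by move=> a u v [Eu Xu] [Ev Xv]; split; [apply: Es.2|apply: Xs.2].
have EXst x m : G i x -> (E `&` X) m -> (E `&` X) (lie_act x m).
  by move=> Gx [Em Xm]; split; [apply: Est|apply: Xact].
have EXfin : finite_dim (E `&` X) by apply: finite_dim_sub Efin _ => // m [].
have [|||q [q_lin qT q_id qC]] := @weyl_local _ _ _ _ (E `&` X)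
  (T `&` E) Gsub Gfin Gss EXfin EXst.
- split; first by split; apply: subspace0.
  by move=> a u v [Tu Eu] [Tv Ev]; split; [apply: Ts.2|apply: Es.2].
- by move=> m [Tm Em]; split=> //; apply: TX.
- by move=> x m Gx [Tm Em]; split; [apply: Tact|apply: Est].
exists (E `&` X), q; split=> //.
- by move=> m Zm; split; [apply: ZE|apply: ZX].
- by split=> // [u /qT[]//|u Tu [Eu _]]; apply: q_id.
Qed.

Lemma word_commute i (E : set M) (q : M -> M) w u :
  (forall x m, G i x -> E m -> E (lie_act x m)) ->
  (forall x u, G i x -> E u -> q (lie_act x u) = lie_act x (q u)) ->
  (forall x, x \in w -> G i x) -> E u -> q (word_act w u) = word_act w (q u).
Proof.
move=> Est qC; elim: w => //= x w IHw wG Eu.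
have wG' y : y \in w -> G i y by move=> yw; apply: wG; rewrite inE yw orbT.
rewrite qC ?IHw//; first by apply: wG; rewrite mem_head.
exact: (word_act_sub Est wG' Eu).
Qed.

(** For [z] in [Z] the weight-[l] part of [q z] lies in [T], so it is zero. Words from [G i] commute
    with [q] and carry this to the other weights. Hence [q] followed by [p mu0] kills [p mu0 y], yet
    [q] fixes this element of [T]. *)
Lemma generated_zero_part l Z T : linear_subspace Z -> finite_dim Z ->
  Z `<=` weight_space l -> submodule T -> T `<=` generated homog Z ->
  (forall m, T m -> weight_space l m -> m = 0) -> forall m, T m -> m = 0.
Proof.
move=> Zs Zfin Zl Tsub TX T0 y Ty; apply: p_eq0 => mu0.
have [Ts Tact] := Tsub.
have [i yi] := generated_exhaust (TX _ Ty).
have {yi} yi := yi i (leqnn i).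
have [E [q [[Es EX] ZE Est [q_lin qT q_id qC]]]] := local_projection i Zs Zfin
  (@sub_generated _ _ _ _ _) (generated_submodule g_span Z) Tsub TX.
have q0 : q 0 = 0 by rewrite q_id//; [exact: subspace0 Ts|exact: subspace0 Es].
suff [Ep q_p] : E (p mu0 y) /\ p mu0 (q (p mu0 y)) = 0.
  have Typ : T (p mu0 y) by exact: (submodule_proj M_direct p_id p_other).
  by rewrite -q_p (q_id _ Typ Ep) (p_id (p_weight _ _)).
(* Membership in [E] is carried along because [q] is linear on [E] only and [E] need not be stable
   under the weight projections. *)
pose R := [set m | forall mu, E (p mu m) /\ p mu (q (p mu m)) = 0].
have Rs : linear_subspace R.
  split=> [mu|a u v Ru Rv mu]; first by rewrite linear0 q0 linear0;
    split=> //; exact: subspace0 Es.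
  have [[E1 p1] [E2 p2]] := (Ru mu, Rv mu).
  rewrite linearP q_lin// linearP p1 p2 scaler0 addr0; split=> //.
  exact: Es.2.
suff H : generated (homog `&` G i) Z `<=` R by exact: H.
apply: linear_span_sub => // _ [w [z [wh Zz ->]]] mu.
have wG x : x \in w -> G i x by case/wh.
have [|beta bE] := word_proj M_direct p_id p_other (w := w).
  by move=> x /wh[].
have [muE|/existsNP[t0 mut0]] := pselect (forall t : h, mu t = l t + beta t).
  rewrite (bE l mu muE) p_id; last exact: Zl.
  split; first exact: (word_act_sub Est wG (ZE _ Zz)).
  rewrite (word_commute Est qC wG (ZE _ Zz)) (bE l mu muE).
  rewrite (T0 (p l (q z))) ?linear0//; apply:
    (submodule_proj M_direct p_id p_other) => //.
  exact/qT/ZE.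
rewrite (bE (mu \- beta : {scalar h}) mu) => [|t]; last by rewrite /= subrK.
rewrite (@p_other l); first by rewrite linear0 q0 linear0; split=> //;
  exact: subspace0 Es.
  move=> /(congr1 (fun f : {scalar h} => f t0))/= E0.
  by apply: mut0; rewrite E0 subrK.
exact: Zl.
Qed.

(* The operators [p l \o word_act w] span a finite-dimensional space of
   endomorphisms of the weight space, so finitely many words suffice. *)
Lemma uniform_words l : finite_dim (@weight_space C g P h M l) -> exists i,
  forall j, (i <= j)%N -> forall Z, linear_subspace Z ->
    Z `<=` weight_space l ->
  (forall w z, (forall x, x \in w -> homog x /\ G j x) -> Z z ->
    Z (p l (word_act w z))) ->
  forall w z, (forall x, x \in w -> homog x) -> Z z -> Z (p l (word_act w z)).
Proof.
move=> /finite_dim_coordinates[n [psi [psi_inj psiE]]].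
have coordE u : exists v, weight_space l u -> psi v = u.
  by have [|nE] := pselect (weight_space l u); [rewrite -{1}psiE => -[v _ <-];
    exists v|exists 0].
have /choice[c cE] := coordE.
pose repr (A : 'M[C]_n) w := forall v, psi (v *m A) = p l (word_act w (psi v)).
have reprE w : exists A, repr A w.
  exists (\matrix_i c (p l (word_act w (psi (delta_mx 0 i))))) => v.
  rewrite mulmx_sum_row linear_sum {2}[v]row_sum_delta !linear_sum.
  by apply: eq_bigr => i _; rewrite rowK !linearZ/= cE.
pose A := [set A | exists2 w, (forall x, x \in w -> homog x) & repr A w].
have [s sA As] := finite_spanning A.
have /choice[wd wdP] : forall B, exists w, B \in s -> (forall x, x \in w ->
  homog x) /\ repr B w.
  move=> B; have [/sA[w wh Bw]|] := boolP (B \in s); last by exists [::].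
  by exists w.
have [i iP] := G_seq (flatten [seq wd B | B <- s]).
exists i => j ij Z Zs Zl Zst w z wh Zz.
have [B Bw] := reprE w.
have psiz : psi (c z) = z by apply/cE/Zl.
rewrite -psiz -Bw.
have : B \in <<s>>%VS by apply: As; exists w.
rewrite -[s]/(tval (in_tuple s)) => /coord_span ->.
rewrite mulmx_sumr linear_sum; apply: subspace_sum => // k _.
rewrite -scalemxAr linearZ; apply: subspaceZ => //=.
have ks : s`_k \in s by rewrite mem_nth.
have [wdh ->] := wdP _ ks.
rewrite psiz; apply: Zst => // x xw; split; first exact: wdh.
apply: (G_le ij); apply: iP; apply/flattenP; exists (wd s`_k) => //.
exact: map_f.
Qed.

Hypothesis M_fin : forall l, finite_dim (@weight_space C g P h M l).

(* [X] is generated by its weight space of weight [l], of minimal dimension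
   among those not contained in [N]. *)
Theorem simple_submodule_avoiding N l : submodule N ->
  ~ (weight_space l `<=` N) ->
  exists X, [/\ submodule X, forall m, X m -> N m ->
    m = 0, exists2 m, X m & m <> 0 &
    forall T, submodule T -> T `<=` X -> (forall m, T m -> m = 0) \/ X `<=` T].
Proof.
move=> Nsub lN.
have [n [psi [psi_inj psiE]]] := finite_dim_coordinates (M_fin l).
have psil v : weight_space l (psi v) by rewrite -psiE; exists v.
pose Q r := `[< exists X, exists W : 'M[C]_n, [/\ submodule X,
  ~ (X `&` weight_space l `<=` N),
  forall v, X (psi v) <-> (v <= W)%MS & \rank W = r] >].
have exQ : exists r, Q r.
  have [W WP] := rowspace_of_subspace (preimage_subspace psi
    (full_subspace M)).
  exists (\rank W); apply/asboolP; exists setT, W; split=> //.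
  by rewrite setTI.
have [_ /asboolP[X0 [W0 [X0sub X0N W0P <-]]] minr] := ex_minnP exQ.
have [X0s X0act] := X0sub; have [Ns Nact] := Nsub.
have ls := @weight_space_subspace C g P h M l.
pose F := X0 `&` weight_space l.
have Fs : linear_subspace F.
  split; first by split; [exact: subspace0 X0s|exact: subspace0 ls].
  by move=> a u v [Xu lu] [Xv lv]; split; [exact: X0s.2|exact: ls.2].
have Ffin : finite_dim F by apply: finite_dim_sub Fs (M_fin l) _ => m [].
have Fl : F `<=` weight_space l by move=> m [].
(* The weight-[l] part of [T] is contained in that of [X0] and competes for the minimum, so both
   have the same rank and coincide. *)
have min_sub T : submodule T -> (forall m, T m -> weight_space l m -> X0 m) ->
    ~ (T `&` weight_space l `<=` N) -> F `<=` T.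
  move=> Tsub TX0 TN m [X0m lm].
  have [W WP] := rowspace_of_subspace (preimage_subspace psi Tsub.1).
  have WW0 : (W <= W0)%MS.
    apply/row_subP => i; apply/W0P/TX0 => //.
    by apply/WP; rewrite row_sub.
  have : (W0 <= W)%MS.
    rewrite -(geq_leqif (mxrank_leqif_sup WW0)); apply: minr.
    by apply/asboolP; exists T, W.
  have [v _ vm] : range psi m by rewrite psiE.
  rewrite -vm in X0m *; move=> W0W; apply/WP; apply: submx_trans W0W.
  exact/W0P.
pose X := generated homog F.
have Xsub : submodule X := generated_submodule g_span F.
have XX0 : X `<=` X0 by apply: generated_sub => // m [].
have XlF m : X m -> weight_space l m -> F m by move=> /XX0.
pose Y := X `&` N.
have Ysub : submodule Y := submoduleI Xsub Nsub.
have proj_sub T m : submodule T -> T m -> T (p l m).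
  exact: (submodule_proj M_direct p_id p_other).
have Yl m : Y m -> weight_space l m -> m = 0.
  have [i iP] := uniform_words (M_fin l).
  have [E [q [[Es EX] FE Est [q_lin qY q_id qC]]]] := local_projection i Fs Ffin
    (@sub_generated _ _ _ homog F) Xsub Ysub (@subIsetl _ X N).
  have q0 : q 0 = 0 by rewrite q_id//; [exact: subspace0 Ysub.1|exact:
    subspace0 Es].
  (* [Z] is the complement of the weight-[l] part of [Y] in [F]. Words from [G i] preserve it, as
     those of weight zero commute with [q] and [p l] and the others have no weight-[l] part; the
     choice of [i] extends this to all homogeneous words. *)
  pose Z := [set v | F v /\ p l (q v) = 0].
  have Zs : linear_subspace Z.
    split; first by split; [exact: subspace0 Fs|rewrite q0 linear0].
    move=> a u v [Fu u0] [Fv v0]; split; first exact: Fs.2.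
    by rewrite q_lin; [rewrite linearP u0 v0 scaler0 addr0|exact: FE|exact: FE].
  have Zl : Z `<=` weight_space l by move=> v [[]].
  have Zst w z : (forall x, x \in w -> homog x) -> Z z ->
    Z (p l (word_act w z)).
    apply: (iP i (leqnn i)) => // {}w {}z wP [[X0z lz] z0].
    have wh x : x \in w -> homog x by case/wP.
    have wG x : x \in w -> G i x by case/wP.
    split.
      split; last exact: p_weight.
      by apply: proj_sub => //; apply: (@word_act_sub _ _ _ setT) =>
        // x m' _; apply: X0act.
    have [wE|w0] := word_proj0 M_direct p_id p_other l wh.
      rewrite wE (p_id lz) (word_commute Est qC wG); last by apply: FE.
      by rewrite wE z0 linear0.
    by rewrite w0// q0 linear0.
  pose T := generated homog Z.
  have Tsub : submodule T := generated_submodule g_span Z.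
  have TZ v : T v -> weight_space l v -> Z v.
    move=> Tv lv; rewrite -(p_id lv).
    suff H : T `<=` p l @^-1` Z by exact: H.
    apply: linear_span_sub; first exact: preimage_subspace.
    by move=> _ [w [z [wh Zz ->]]]; apply: Zst.
  (* If [Z] were inside [N], so would be [F], each [v] being the sum of [v - p l (q v)] in [Z] and
     [p l (q v)] in [Y]. Otherwise minimality puts [F] inside the module generated by [Z], hence
     inside [Z], where [p l \o q] vanishes although it fixes [m]. *)
  have [ZN|/existsNP[z /not_implyP[Zz nNz]]] := pselect (Z `<=` N).
    case: X0N => v Fv; have Ev := FE v Fv.
    have Yqv : Y (p l (q v)) by apply: proj_sub => //; apply: qY.
    have Fqv : F (p l (q v)) by apply: XlF; [exact: Yqv.1|exact: p_weight].
    rewrite -(subrK (p l (q v)) v); apply: (subspaceD Ns); last exact: Yqv.2.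
    apply: ZN; split; first exact: subspaceB.
    have -> : v - p l (q v) = (-1) *: p l (q v) + v by rewrite scaleN1r addrC.
    rewrite q_lin//; last exact: FE.
    rewrite (q_id _ Yqv (FE _ Fqv)) linearP (p_id (p_weight _ _)).
    by rewrite scaleN1r addNr.
  move=> Ym lm.
  have FT : F `<=` T.
    apply: min_sub => // [v Tv lv|TN]; first by case: (TZ v Tv lv) => -[].
    by apply/nNz/TN; split; [exact: sub_generated|exact: Zl].
  have Fm : F m by apply: XlF => //; exact: Ym.1.
  have [_] := TZ m (FT _ Fm) lm.
  by rewrite (q_id _ Ym (FE _ Fm)) p_id.
have Y0 m : Y m -> m = 0.
  by apply: (generated_zero_part Fs Ffin Fl Ysub) => //; apply: subIsetl.
exists X; split=> //.
- by move=> m Xm Nm; apply: Y0.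
- have /existsNP[m /not_implyP[Fm nNm]] := X0N.
  exists m; first exact: sub_generated.
  by move=> m0; apply: nNm; rewrite m0; exact: subspace0 Ns.
move=> T Tsub TX.
(* A nonzero weight-[l] vector of [T] is outside [N], as [X] meets [N] trivially; minimality then
   gives all of [F]. *)
have [Tl0|/existsNP[m /not_implyP[Tm /not_implyP[lm m0]]]] :=
    pselect (forall m, T m -> weight_space l m -> m = 0).
  by left; apply: (generated_zero_part Fs Ffin Fl Tsub).
right; apply: generated_sub => //; apply: min_sub => // [v /TX/XX0//|TN].
by apply/m0/Y0; split; [apply: TX|apply: TN].
Qed.

End SimpleSubmodules.

(** * Semisimplicity *)

Section IndependentFamilies.
Variables (K : fieldType) (V : lmodType K).
Implicit Types (A : set (set V)) (X : set V).

(** A set of subspaces rather than an indexed family, so that Zorn's lemma applies to unions of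
    chains. *)
Definition independent A := forall (s : seq {classic (set V)}) (w : {classic
  (set V)} -> V),
  uniq s -> (forall X, X \in s -> A X /\ (X : set V) (w X)) ->
    \sum_(X <- s) w X = 0 ->
  forall X, X \in s -> w X = 0.

(** A relation involves finitely many subspaces, and along a chain a single member contains them
    all. *)
Lemma independent_bigcup (F : set (set (set V))) : total_on F subset ->
  (forall A, F A -> independent A) -> independent (\bigcup_(A in F) A).
Proof.
move=> Ftot Find s w us sF s0 X Xs.
have H : forall t : seq {classic (set V)}, t != [::] ->
    (forall X, X \in t -> (\bigcup_(A in F) A) X) ->
    exists2 A, F A & forall X, X \in t -> A X.
  elim=> // Y t IHt _ tF; have [B FB BY] := tF Y (mem_head _ _).
  have [->|t0] := eqVneq t [::].
    by exists B => // Z; rewrite inE => /eqP ->.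
  have [Z Zt|A FA At] := IHt t0; first by apply: tF; rewrite inE Zt orbT.
  have [AB|BA] := Ftot _ _ FA FB.
    exists B => // Z; rewrite inE => /predU1P[->//|Zt].
    exact/AB/At.
  exists A => // Z; rewrite inE => /predU1P[->|]; [exact: BA|exact: At].
have [|Y /sF[]//|A FA sA] := H s; first by case: s Xs {us sF s0}.
apply: (Find A FA s w) => // Y Ys; split; first exact: sA.
exact: (sF Y Ys).2.
Qed.

Lemma independent_setU1 A X : independent A -> (forall Y, A Y ->
  linear_subspace Y) ->
  linear_subspace X -> (forall v, X v -> linear_span
    (\bigcup_(Y in A) Y) v -> v = 0) ->
  independent (A `|` [set X]).
Proof.
move=> Aind As Xs X0 s w us sA s0.
have [Xin|Xout] := boolP ((X : {classic (set V)}) \in s); last first.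
  apply: Aind => // Y Ys; have [[AY|YX] Yw] := sA Y Ys => //.
  by rewrite -YX Ys in Xout.
have remP Y : Y \in rem (X : {classic (set V)}) s -> A Y /\ (Y : set V) (w Y).
  rewrite mem_rem_uniq// inE => /andP[/eqP YX Ys].
  by have [[AY|]] := sA Y Ys.
have sE : w X + \sum_(Y <- rem (X : {classic (set V)}) s) w Y = 0.
  by rewrite -[RHS]s0 (perm_big _ (perm_to_rem Xin)) big_cons.
have wX : w X = 0.
  apply: X0; first exact: (sA _ Xin).2.
  move/eqP: sE; rewrite addr_eq0 => /eqP ->.
  have sp := linear_span_subspace (\bigcup_(Y in A) Y).
  apply: (subspaceN sp); rewrite big_seq;
    apply: (subspace_sum sp) => Y /remP[AY Yw].
  by apply: (@sub_linear_span _ _ (\bigcup_(Y in A) Y)); exists Y.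
move=> Y Ys; have [->//|YX] := eqVneq Y (X : {classic (set V)}).
apply: (Aind (rem (X : {classic (set V)}) s) w) => //; first exact: rem_uniq.
  by rewrite wX add0r in sE.
by rewrite mem_rem_uniq// inE YX.
Qed.

Lemma maximal_independent (Q : set (set V)) : (forall X, Q X ->
  linear_subspace X) ->
  exists A, [/\ A `<=` Q, independent A &
    forall X, Q X -> (forall v, X v -> linear_span (\bigcup_(Y in A) Y) v ->
      v = 0) -> X `<=` [set 0]].
Proof.
move=> Qs.
have [|A [[AQ Aind] Amax]] := @Zorn_bigcup _ [set A | A `<=` Q /\ independent
  A].
  move=> F FP Ftot; split; first by move=> X [A /FP[AQ _] /AQ].
  by apply: independent_bigcup => // A /FP[].
exists A; split=> // X QX X0 v Xv.
have [AX|nAX] := pselect (A X).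
  apply: X0 => //; apply: (@sub_linear_span _ _ (\bigcup_(Y in A) Y));
    by exists X.
case: (Amax (A `|` [set X])).
  split; first by move=> Y AY; left.
  by move=> /(_ X (or_intror erefl)).
split; first by move=> Y [/AQ//|->].
by apply: independent_setU1 => // [Y /AQ|]; exact: Qs.
Qed.

Lemma independent_direct_sum A (I : Type) (F : I -> set V) : independent A ->
  (forall i, A (F i)) -> injective F -> (forall X, A X -> exists i, F i = X) ->
  linear_span (\bigcup_(X in A) X) = setT -> direct_sum F.
Proof.
move=> Aind AF Finj FA AT; split.
  apply/seteqP; split=> // v _.
  have : linear_span (\bigcup_(X in A) X) v by rewrite AT.
  by apply: linear_span_mono => u [X /FA[i <-] Xu]; exists i.
move=> n i v iinj Fv v0 k.
pose s : seq {classic (set V)} := [seq F (i k) | k <- enum 'I_n].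
pose w (Y : {classic (set V)}) := \sum_(k < n | (F (i k) : {classic
  (set V)}) == Y) v k.
have wE j : w (F (i j)) = v j.
  rewrite /w (bigD1 j)//= big1 ?addr0// => l /andP[/eqP /Finj/iinj -> ].
  by rewrite eqxx.
have /(_ _ _ _ (F (i k))) := Aind s w; rewrite wE; apply.
- by rewrite map_inj_uniq ?enum_uniq// => j l /Finj/iinj.
- by move=> Y /mapP[j _ ->]; split; [exact: AF|rewrite wE].
- by rewrite big_map big_enum/= -[RHS]v0; apply: eq_bigr => j _.
- by apply/mapP; exists k; rewrite ?mem_enum.
Qed.

End IndependentFamilies.

Lemma finite_dim_injective (K : fieldType) (U V : lmodType K)
  (f : {linear U -> V})
    (A : set U) : injective f -> finite_dim (f @` A) -> finite_dim A.
Proof.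
move=> finj /finite_dim_coordinates[n [psi [psi_inj psiE]]].
have /choice[c cP] : forall v, exists u, A u /\ f u = psi v.
  move=> v; have [u Au uv] : (f @` A) (psi v) by rewrite -psiE; exists v.
  by exists u.
have c_lin : linear c.
  by move=> a u v; apply: finj; rewrite linearP !(cP _).2 linearP.
suff -> : A = range (linear_of c_lin) by exact: finite_dim_range.
apply/seteqP; split=> [u Au|_ [v _ <-]]; last exact: (cP v).1.
have [v _ vu] : range psi (f u) by rewrite psiE; exists u.
by exists v => //; apply: finj; rewrite -vu; exact: (cP v).2.
Qed.

(** * Submodules as objects of the category *)

Section SubmoduleType.
Variables (K : fieldType) (g : lieAlgType K) (M : lieModType g) (N : set M).
Hypothesis Nsub : submodule N.

Definition submodule_type := subspace_type Nsub.1.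
HB.instance Definition _ := GRing.Lmodule.on submodule_type.

Definition sub_lie_act x (u : submodule_type) : submodule_type :=
  to_subspace Nsub.1 (Nsub.2 x _ (in_subspace u)).

Fact sub_act_linearl a x y u :
  sub_lie_act (a *: x + y) u = a *: sub_lie_act x u + sub_lie_act y u.
Proof. by apply: val_inj; rewrite /= act_linearl. Qed.

Fact sub_act_linearr a x u v :
  sub_lie_act x (a *: u + v) = a *: sub_lie_act x u + sub_lie_act x v.
Proof. by apply: val_inj; rewrite /= act_linearr. Qed.

Fact sub_act_bracket x y u : sub_lie_act (bracket x y) u =
  sub_lie_act x (sub_lie_act y u) - sub_lie_act y (sub_lie_act x u).
Proof. by apply: val_inj; rewrite /= act_bracket. Qed.

HB.instance Definition _ := Lmodule_isLieModule.Build K g submodule_type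
  sub_act_linearl sub_act_linearr sub_act_bracket.

Definition submodule_incl (u : submodule_type) : M := subspace_val u.

Fact submodule_incl_is_linear : linear submodule_incl.
Proof. by []. Qed.
HB.instance Definition _ := GRing.isLinear.Build K submodule_type M *:%R
  submodule_incl submodule_incl_is_linear.

Lemma submodule_incl_hom : @module_hom K g submodule_type M submodule_incl.
Proof. by []. Qed.

Lemma submodule_incl_inj : injective submodule_incl.
Proof. by move=> u v uv; apply: val_inj. Qed.

Lemma range_submodule_incl : range submodule_incl = N.
Proof.
apply/seteqP; split=> [_ [u _ <-]|m Nm]; first exact: in_subspace.
by exists (to_subspace Nsub.1 Nm).
Qed.

End SubmoduleType.

Section Subobjects.
Variables (K : fieldType) (g : lieAlgType K) (P : {pred g}) (h : subLmodType P).
Variables (M : lieModType g) (N : set M).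
Hypothesis Nsub : submodule N.
Let X : lieModType g := submodule_type Nsub.
Let incl : {linear X -> M} := submodule_incl (Nsub := Nsub).

Lemma submodule_Int_g : Int_g M -> Int_g X.
Proof.
move=> Mint x u.
apply: (finite_dim_injective (f := incl)); first exact: submodule_incl_inj.
rewrite -linear_span_image.
suff -> : incl @` range (fun n => iter n (lie_act x) u) =
    range (fun n => iter n (lie_act x) (incl u)) by exact: Mint.
have iterE n : incl (iter n (lie_act x) u) = iter n (lie_act x) (incl u).
  by elim: n => //= n <-.
apply/seteqP; split=> [_ [_ [n _ <-] <-]|_ [n _ <-]]; first by exists n.
by exists (iter n (lie_act x) u); [exists n|exact: iterE].
Qed.

Lemma weight_space_incl (l : {scalar h}) (u : X) :
  weight_space l u <-> weight_space l (incl u).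
Proof.
split=> ul t; first by rewrite -[LHS]/(incl (lie_act (val t) u)) ul linearZ.
by apply: submodule_incl_inj; rewrite -[LHS]/(lie_act (val t)
  (incl u)) ul -[RHS]/(incl _) linearZ.
Qed.

(** The weight components of an element of [N] lie in [N] by [submodule_proj], so the decomposition
    of [M] restricts. *)
Lemma submodule_direct_sum : direct_sum (@weight_space K g P h M) ->
  direct_sum (@weight_space K g P h X).
Proof.
move=> Mdir; have [p [pw pid poth p0]] :=
  direct_sum_projections (@weight_space_subspace K g P h M) Mdir.
split; last first.
  move=> n i v iinj vw v0 k; apply: submodule_incl_inj.
  rewrite -[RHS]/(incl 0) linear0.
  apply: (Mdir.2 n i (fun k => incl (v k)) iinj) => [j|];
    first exact/weight_space_incl.
  by rewrite -(linear_sum incl) v0 linear0.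
apply/seteqP; split=> // u _.
have : linear_span (\bigcup_(i in setT) @weight_space K g P h M i) (incl u).
  by rewrite Mdir.1.
move=> /(span_bigcup_decomposition (@weight_space_subspace K g P h M))[s [w [us
  _ ww uE]]].
have Nu : N (incl u) by exact: in_subspace.
have Np l : N (p l (incl u)) by exact: (submodule_proj Mdir pid poth).
pose c l : X := to_subspace Nsub.1 (Np l).
have -> : u = \sum_(l <- s) c l.
  apply: submodule_incl_inj; rewrite -[RHS]/(incl _) linear_sum -[LHS]/(incl u)
    [LHS]uE.
  rewrite big_seq [RHS]big_seq; apply: eq_bigr => l ls /=.
  rewrite -[RHS]/(p l (incl u)) uE linear_sum
    (bigD1_seq l)//= pid// big1 ?addr0// => j /eqP jl.
  exact: poth (ww j).
have sp := linear_span_subspace (\bigcup_l @weight_space K g P h X l).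
apply: (subspace_sum sp) => l _.
apply: (@sub_linear_span _ _ (\bigcup_l @weight_space K g P h X l));
  exists l => //.
by apply/weight_space_incl; exact: pw.
Qed.

Lemma submodule_Int_fin : Int_fin h M -> Int_fin h X.
Proof.
move=> [[Mint Mdir] Mfin]; split.
  by split; [exact: submodule_Int_g|exact: submodule_direct_sum].
move=> l; apply: (finite_dim_injective (f := incl));
  first exact: submodule_incl_inj.
apply: finite_dim_sub (Mfin l) _; first
  exact/image_subspace/weight_space_subspace.
by move=> _ [u ul <-]; apply/weight_space_incl.
Qed.

End Subobjects.

Definition simple_submodule (K : fieldType) (g : lieAlgType K)
  (M : lieModType g) (N : set M) :=
  [/\ submodule N, exists2 m, N m & m <> 0 &
    forall T, submodule T -> T `<=` N -> (forall m, T m -> m = 0) \/ N `<=` T].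

Lemma simple_submodule_object (K : fieldType) (g : lieAlgType K) (P : {pred g})
    (h : subLmodType P) (M : lieModType g) (N : set M) (Nsub : submodule N) :
  Int_fin h M -> simple_submodule N -> simple_object (Int_fin h)
    (submodule_type Nsub).
Proof.
move=> Mfin [_ [m Nm m0] Nsimple]; split; first exact: submodule_Int_fin.
  exists (to_subspace Nsub.1 Nm); apply/eqP =>
    /(congr1 (@submodule_incl _ _ _ _ Nsub)).
  exact: m0.
move=> N' f _ f_hom f_inj.
pose incl : {linear submodule_type Nsub -> M} := submodule_incl (Nsub := Nsub).
pose T := range (incl \o f).
have Tsub : submodule T.
  split; first exact: (image_subspace (incl \o f) (full_subspace N')).
  by move=> x _ [u _ <-]; exists (lie_act x u) => //; rewrite /= f_hom.
have TN : T `<=` N by move=> _ [u _ <-]; exact: in_subspace.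
have [T0|NT] := Nsimple T Tsub TN; [left|right]; apply/seteqP; split=> //.
- move=> _ [u _ <-]; apply: submodule_incl_inj.
  by rewrite -[RHS]/(incl 0) linear0; apply: T0; exists u.
- by move=> _ ->; exists 0 => //; rewrite linear0.
- move=> u _; have [v _ vu] : T (incl u) := NT _ (in_subspace u).
  by exists v => //; apply: submodule_incl_inj; exact: vu.
Qed.

Theorem theorem3p7 (R : realType) (g : lieAlgType R[i]) (P : {pred g})
    (h : subLmodType P) (g_lss : locally_semisimple g)
    (h_cartan : splitting_cartan h) :
  semisimple_category (Int_fin h).
Proof.
move=> M Mfin; have [[Mint Mdir] Mwfin] := Mfin.
have [G [Gss Gmono Gcover]] := g_lss.
have [h_abelian [h_span _]] := h_cartan.
have g_span : linear_span (homogeneous h) = setT.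
  apply/seteqP; split=> // x _.
  have : [set: g] x by [].
  rewrite -h_span; apply: linear_span_mono => {x}x [[alpha|] _ /= xa];
    first by exists (sval alpha).
  exists (\0 : {scalar h}) => t; rewrite scale0r.
  by have := h_abelian t (Sub x xa); rewrite SubK.
have [p [pw pid poth p0]] := direct_sum_projections
  (@weight_space_subspace _ g P h M) Mdir.
have [|A [AQ Aind Amax]] := @maximal_independent _ M (@simple_submodule _ g M).
  by move=> X [[]].
pose N := linear_span (\bigcup_(Y in A) Y).
have Nsub : submodule N.
  split=> [|x m]; first exact: linear_span_subspace.
  apply: lie_act_span1 => [|n [Y AY Yn]]; first exact: linear_span_subspace.
  apply: (@sub_linear_span _ _ (\bigcup_(Y in A) Y)); exists Y => //.
  by have [[_ Yact] _ _] := AQ Y AY; apply: Yact.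
(* A weight space outside [N] would yield a simple submodule meeting [N] trivially, which maximality
   of [A] forces to be zero. *)
have NT : N = setT.
  apply/seteqP; split=> // m _; apply: (weight_induction Mdir Nsub.1) => l.
  apply: contrapT => lN.
  have [X [Xsub XN X0 Xsimple]] :=
    simple_submodule_avoiding Gss Gmono Gcover g_span Mint Mdir pw pid poth p0
      Mwfin Nsub lN.
  have X00 := Amax X (And3 Xsub X0 Xsimple) XN.
  by have [n /X00] := X0.
have subA (X : {X | A X}) : submodule (sval X) by have [] := AQ _ (svalP X).
exists {X | A X}, (fun X => submodule_type (subA X)),
  (fun X => submodule_incl (Nsub := subA X)); split.
- move=> X; apply: simple_submodule_object => //; exact: AQ (svalP X).
- by move=> X; split; [exact: submodule_incl_hom|exact: submodule_incl_inj].
- have rE X : range (submodule_incl (Nsub :=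
  subA X)) = sval X by exact: range_submodule_incl.
  apply: (independent_direct_sum Aind) => //.
  + by move=> X; rewrite rE; exact: svalP.
  + move=> X Y; rewrite !rE; case: X Y => [X AX] [Y AY] /= XY.
    by move: AX; rewrite XY => AX; rewrite (Prop_irrelevance AX AY).
  + by move=> X AX; exists (exist _ X AX); rewrite rE.
Qed.
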